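(* The antipode $S_{GL}$ of the Grossman-Larson Hopf algebra $\mathcal H_{GL}$ of ordered trees has the following cancellation-free formula: for every ordered tree $\tau=B^+(\tau_1\cdots\tau_m)$, where $\tau_1,\dots,\tau_m$ are ordered trees, $$S_{GL}(\tau)=(-1)^m\sum_\pi B^+\big((\tau^-_{B_1}\blacktriangleright\tau_{b_1})\cdots(\tau^-_{B_{|\pi|-1}}\blacktriangleright\tau_{b_{|\pi|-1}})\big),$$ where the sum ranges over all partitions $\pi$ of $[m]=\{1,\dots,m\}$ into a tuple $(B_1,\dots,B_{|\pi|})$ of pairwise disjoint, possibly empty subsets with union $[m]$, such that the last one has exactly $|\pi|-1$ elements, written $B_{|\pi|}=\{b_1>\cdots>b_{|\pi|-1}\}$. Here $\tau^-_I=\tau_{i_1}\cdots\tau_{i_r}$ is an ordered forest for $I=\{i_1<\cdots<i_r\}\subseteq[m]$, and $\tau^-_\emptyset=1$.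
   Context: $\mathbf k$ is an algebraically closed field of characteristic $0$. Let $\mathcal{OT}$ be the set of isomorphism classes of ordered (planar rooted) trees, and $\mathcal{OF}$ the set of ordered forests, i.e. finite words $\tau_1\cdots\tau_m$ of ordered trees, with the empty forest denoted $1$. $\mathbf k\{\mathcal{OT}\}$ is the vector space with basis $\mathcal{OT}$, and $\mathbf k\{\mathcal{OF}\}=\mathsf T(\mathbf k\{\mathcal{OT}\})$ is its tensor algebra (product: concatenation of forests). Left grafting: $\tau\curvearrowright\omega=\sum_{s\in\mathrm{Nodes}(\omega)}\tau\curvearrowright_s\omega$, where $\tau\curvearrowright_s\omega$ is the ordered tree obtained by attaching the root of $\tau$ by a new edge to the node $s$ of $\omega$ as its leftmost child. $B^+:\mathbf k\{\mathcal{OF}\}\to\mathbf k\{\mathcal{OT}\}$ is the linear map sending $\tau_1\cdots\tau_m$ to the tree obtained by grafting $\tau_1,\dots,\tau_m$ in this order on a new common root; $B^+(1)$ is the one-node tree. $\mathcal H_{GL}=(\mathbf k\{\mathcal{OT}\},\circ_{GL},\Delta_{GL},S_{GL})$: for $\tau=B^+(\tau_1\cdots\tau_m)$ and $\omega\in\mathcal{OT}$, $\tau\circ_{GL}\omega$ is the partial sum of $\tau_1\curvearrowright(\tau_2\curvearrowright\cdots(\tau_m\curvearrowright\omega)\cdots)$ consisting of those terms in which all of $\tau_1,\dots,\tau_m$ are grafted on nodes of $\omega$ only; the coproduct is $\Delta_{GL}(\tau)=\sum_{I\subseteq[m]}\tau^+_I\otimes\tau^+_{[m]\setminus I}$ with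 $\tau^+_I=B^+(\prod_{i\in I}\tau_i)$ (product in increasing order of $i$). The unit is the one-node tree; $S_{GL}$ denotes the antipode (known to exist). The product $\blacktriangleright$ on $\mathbf k\{\mathcal{OF}\}$: equip $\mathbf k\{\mathcal{OF}\}$ with the coshuffle coproduct $\Delta$ (the algebra map with $\Delta(\tau)=\tau\otimes1+1\otimes\tau$ for $\tau\in\mathcal{OT}$; Sweedler notation $\Delta(X)=X_1\otimes X_2$, and the iterated coproduct $X_1\otimes\cdots\otimes X_m$) and counit $\varepsilon$. Extend $\curvearrowright$ to a product $\rhd$ on $\mathbf k\{\mathcal{OF}\}$ by: $\tau\rhd\omega=\tau\curvearrowright\omega$ for $\tau,\omega\in\mathcal{OT}$; $1\rhd\omega=\omega$; $(\tau\tau_1\cdots\tau_n)\rhd\omega=\tau\rhd\big((\tau_1\cdots\tau_n)\rhd\omega\big)-\sum_{i=1}^n\big(\tau_1\cdots\tau_{i-1}(\tau\curvearrowright\tau_i)\tau_{i+1}\cdots\tau_n\big)\rhd\omega$; $X\rhd1=\varepsilon(X)1$; and $X\rhd(\omega_1\cdots\omega_k)=(X_1\rhd\omega_1)\cdots(X_k\rhd\omega_k)$. With $X\circ Y=X_1(X_2\rhd Y)$, $(\mathbf k\{\mathcal{OF}\},\circ,1,\Delta,\varepsilon)$ is a Hopf algebra; denote its antipode by $S_\rhd$. Then $X\blacktriangleright Y:=(-1)^{|X|}S_\rhd(X)\rhd Y$ for forests $X,Y$, where $|X|$ is the number of trees in $X$; extend bilinearly. ''Cancellation-free'' means that each summand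 $B^+\big((\tau^-_{B_1}\blacktriangleright\tau_{b_1})\cdots(\tau^-_{B_{|\pi|-1}}\blacktriangleright\tau_{b_{|\pi|-1}})\big)$ is a linear combination of ordered trees with positive integer coefficients, so that no cancellations occur in the sum. *)

(* Defs.v *)
From HB Require Import structures.
From mathcomp Require Import all_boot all_algebra.
From mathcomp Require Import finmap monalg.

Set Implicit Arguments.
Unset Strict Implicit.
Unset Printing Implicit Defensive.

Import GRing.Theory.
Local Open Scope ring_scope.

(* [Node f] is B^+(f): the children of the root, listed from left to right. *)
Unset Elimination Schemes.
Inductive otree : Type := Node of seq otree.
Set Elimination Schemes.

Definition children (w : otree) : seq otree := let: Node f := w in f.

Fixpoint otree_ind (P : otree -> Prop)
    (H : forall f, foldr (fun t Q => P t /\ Q) True f -> P (Node f))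
    (w : otree) {struct w} : P w :=
  let: Node f := w in
  H f ((fix all_ind f : foldr (fun t Q => P t /\ Q) True f :=
          if f is t :: f' then conj (otree_ind H t) (all_ind f') else I) f).

Fixpoint otree_encode (w : otree) : GenTree.tree unit :=
  let: Node f := w in GenTree.Node 0 (map otree_encode f).

Fixpoint otree_decode (g : GenTree.tree unit) : otree :=
  if g is GenTree.Node _ l then Node (map otree_decode l) else Node [::].

Lemma otree_encodeK : cancel otree_encode otree_decode.
Proof.
elim=> f IH /=; congr Node.
by elim: f IH => //= t f IHf [-> /IHf ->].
Qed.

HB.instance Definition _ := Choice.copy otree (can_type otree_encodeK).

(* The library's free monoid: words of trees, product = concatenation. *)
Notation oforest := {fmonom otree}.

Definition one_node : otree := Node [::].
Definition tree_forest (t : otree) : oforest := FMonom [:: t].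

(* Nodes are addressed by paths from the root in which the children of a node
   are numbered from the right, starting at 0.  Grafting a new leftmost child
   therefore leaves the addresses of all the old nodes unchanged. *)
Fixpoint nodes (w : otree) : seq (seq nat) :=
  let: Node f := w in
  [::] :: (fix nodesf (f : seq otree) : seq (seq nat) :=
             if f is t :: f' then [seq size f' :: s | s <- nodes t] ++ nodesf f'
             else [::]) f.

Fixpoint graft_at (t : otree) (s : seq nat) (w : otree) {struct s} : otree :=
  let: Node f := w in
  if s is i :: s' then
    Node ((fix graftf (f : seq otree) : seq otree :=
             if f is u :: f' then
               if size f' == i then graft_at t s' u :: f' else u :: graftf f'
             else [::]) f)
  else Node (t :: f).

(* [{malg R[M * N]}] is the tensor product of [{malg R[M]}] and [{malg R[N]}];
   this instance gives it the product (a (x) b) (c (x) d) = ac (x) bd. *)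
Section PairMonomial.
Variables M N : monomType.

Definition pair_one : M * N := (mone, mone).
Definition pair_mul (p q : M * N) : M * N := (mmul p.1 q.1, mmul p.2 q.2).

Lemma pair_mulA : associative pair_mul.
Proof. by move=> p q r; rewrite /pair_mul /= !mulmA. Qed.
Lemma pair_mul1 : left_id pair_one pair_mul.
Proof. by case=> a b; rewrite /pair_mul /= !mul1m. Qed.
Lemma pair_mulm1 : right_id pair_one pair_mul.
Proof. by case=> a b; rewrite /pair_mul /= !mulm1. Qed.
Lemma pair_unitm p q : pair_mul p q = pair_one -> p = pair_one /\ q = pair_one.
Proof.
by case: p q => [a b] [c d] [] /unitm [-> ->] /unitm [-> ->].
Qed.

HB.instance Definition _ := Choice_isMonomialDef.Build (M * N)%type
  pair_mulA pair_mul1 pair_mulm1 pair_unitm.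
End PairMonomial.

Section Linear.
Variable k : fieldType.

Definition linext (K : choiceType) (V : lmodType k) (f : K -> V)
    (x : {malg k[K]}) : V := \sum_(a <- msupp x) x@_a *: f a.

Definition bilinext (K L : choiceType) (V : lmodType k) (f : K -> L -> V)
    (x : {malg k[K]}) (y : {malg k[L]}) : V :=
  linext (fun a => linext (f a) y) x.

Section Antipode.
Variables (K : choiceType).
Variables (mul : {malg k[K]} -> {malg k[K]} -> {malg k[K]}) (one : {malg k[K]}).
Variables (Delta : {malg k[K]} -> {malg k[(K * K)%type]}) (eps : {malg k[K]} -> k).

Definition convolution (f g : {malg k[K]} -> {malg k[K]}) (x : {malg k[K]}) :
    {malg k[K]} :=
  linext (fun p : K * K => mul (f << p.1 >>) (g << p.2 >>)) (Delta x).

Definition is_antipode (S : {linear {malg k[K]} -> {malg k[K]}}) : Prop :=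
  forall x, convolution S id x = eps x *: one /\
            convolution id S x = eps x *: one.
End Antipode.

Definition in_forests : {malg k[otree]} -> {malg k[oforest]} :=
  linext (fun t => << tree_forest t >>).

Definition Bplus : {malg k[oforest]} -> {malg k[otree]} :=
  linext (fun X : oforest => << Node X >>).

Definition lgraft (t w : otree) : {malg k[otree]} :=
  \sum_(s <- nodes w) << graft_at t s w >>.

(* t_I for t = t_1 ... t_m, in increasing order of the indices: [enum I] is
   increasing. *)
Definition subforest m (t : m.-tuple otree) (I : {set 'I_m}) : oforest :=
  FMonom [seq tnth t i | i <- enum I].

(* Each of the trees t_1, ..., t_m is grafted on the nodes of [w] only, in the
   order t_m, ..., t_1. *)
Definition GLmul_tree (t w : otree) : {malg k[otree]} :=
  foldr (fun u => linext (fun w' => \sum_(s <- nodes w) << graft_at u s w' >>))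
        << w >> (children t).

Definition GLmul : {malg k[otree]} -> {malg k[otree]} -> {malg k[otree]} :=
  bilinext GLmul_tree.

Definition GLcoprod_tree (t : otree) : {malg k[(otree * otree)%type]} :=
  let f := in_tuple (children t) in
  \sum_(I : {set 'I_(size (children t))})
     << (Node (subforest f I), Node (subforest f (~: I))) >>.

Definition GLcoprod : {malg k[otree]} -> {malg k[(otree * otree)%type]} :=
  linext GLcoprod_tree.

Definition GLcounit (x : {malg k[otree]}) : k := x@_one_node.

Definition is_GL_antipode (S : {linear {malg k[otree]} -> {malg k[otree]}}) :=
  is_antipode GLmul << one_node >> GLcoprod GLcounit S.

Definition coshuffle_forest (X : oforest) : {malg k[(oforest * oforest)%type]} :=
  \prod_(t <- X) (<< (tree_forest t, mone) >> + << (mone, tree_forest t) >>).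

Definition coshuffle : {malg k[oforest]} -> {malg k[(oforest * oforest)%type]} :=
  linext coshuffle_forest.

Definition counit (x : {malg k[oforest]}) : k := x@_mone.

(* X |> w for a forest X and a tree w.  The defining recursion replaces a
   forest by forests with one tree less, so it is run on the number [n] of
   trees of [X]. *)
Fixpoint rhd_tree_rec (n : nat) (X : seq otree) (w : otree) :
    {malg k[otree]} :=
  match n, X with
  | n'.+1, t :: X' =>
      linext (lgraft t) (rhd_tree_rec n' X' w)
      - \sum_(i < size X')
          linext (fun u => rhd_tree_rec n' (take i X' ++ u :: drop i.+1 X') w)
                 (lgraft t (nth t X' i))
  | _, _ => << w >>
  end.

Definition rhd_tree (X : seq otree) (w : otree) : {malg k[otree]} :=
  rhd_tree_rec (size X) X w.

Lemma rhd_tree_nil w : rhd_tree [::] w = << w >>.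
Proof. by []. Qed.

Lemma rhd_tree_cons t X w :
  rhd_tree (t :: X) w =
    linext (lgraft t) (rhd_tree X w)
    - \sum_(i < size X)
        linext (fun u => rhd_tree (take i X ++ u :: drop i.+1 X) w)
               (lgraft t (nth t X i)).
Proof.
rewrite /rhd_tree /=; congr (_ - _); apply: eq_bigr => i _.
apply: eq_bigr => u _; congr (_ *: rhd_tree_rec _ _ _).
by rewrite size_cat /= size_drop size_takel ?addnS -?addSn ?subnKC // ltnW.
Qed.

(* X |> (w_1 ... w_l) = (X_1 |> w_1) ... (X_l |> w_l): the iterated coproduct
   is unfolded one factor at a time. *)
Fixpoint rhd_forest (X : oforest) (Y : seq otree) : {malg k[oforest]} :=
  if Y is w :: Y' then
    linext (fun p : oforest * oforest =>
              in_forests (rhd_tree p.1 w) * rhd_forest p.2 Y')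
           (coshuffle_forest X)
  else counit << X >> *: 1.

Definition rhd : {malg k[oforest]} -> {malg k[oforest]} -> {malg k[oforest]} :=
  bilinext (fun X Y : oforest => rhd_forest X Y).

Definition circ (x y : {malg k[oforest]}) : {malg k[oforest]} :=
  linext (fun p : oforest * oforest => << p.1 >> * rhd << p.2 >> y)
         (coshuffle x).

Definition is_rhd_antipode
    (S : {linear {malg k[oforest]} -> {malg k[oforest]}}) :=
  is_antipode circ 1 coshuffle counit S.

Definition btri (S : {malg k[oforest]} -> {malg k[oforest]}) :
    {malg k[oforest]} -> {malg k[oforest]} -> {malg k[oforest]} :=
  bilinext (fun X Y : oforest => (-1) ^+ fdeg X *: rhd (S << X >>) << Y >>).

(* Tuples (B_1, ..., B_(q+1)) of pairwise disjoint, possibly empty sets with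
   union [m], the last of which has q elements. *)
Definition GLpartition m q (B : q.+1.-tuple {set 'I_m}) : bool :=
  [&& [forall i, forall j, (i != j) ==> [disjoint tnth B i & tnth B j]],
      \bigcup_i tnth B i == [set: 'I_m]
    & #|tnth B ord_max| == q].

(* The list [rev (enum B_(q+1))] is b_1 > ... > b_q. *)
Definition GLterm (S : {malg k[oforest]} -> {malg k[oforest]})
    m (t : m.-tuple otree) q (B : q.+1.-tuple {set 'I_m}) : {malg k[otree]} :=
  Bplus (\prod_(p <- zip (take q B) (rev (enum (tnth B ord_max))))
           btri S << subforest t p.1 >> << tree_forest (tnth t p.2) >>).

Definition positive_integer_coefs (x : {malg k[otree]}) : Prop :=
  forall s, s \in msupp x -> exists n : nat, (0 < n)%N /\ x@_s = n%:R.
End Linear.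

(* Main.v *)
(* Both antipodes are determined, by recursion on the number of trees, by the
   equation id * S = eps alone.  Writing D_t for grafting t on the trees of a
   word, which is a derivation of concatenation and a coderivation of the
   coshuffle coproduct, L_X = X |> - satisfies L_{tX} = D_t L_X - L_{D_t X}.
   Operators P_X given by P_1 = id and P_{tX} = P_X D_t + P_{D_t X} are then
   multiplicative along the coproduct, and (-1)^|X| P_X is the convolution
   inverse of L_X, so that P_X(Y) is the black triangle product of X and Y; the
   recursion for P has no signs, whence positivity.  It follows that
   S(X) = (-1)^|X| sum P_{X_1}(rev X_2), which expands into the sum over
   partitions by multiplicativity.  Finally B^+ intertwines the product o with
   the Grossman-Larson product, as grafting on the old nodes only obeys the
   same recursion as L_X. *)

Require Import Defs.
From HB Require Import structures.
From mathcomp Require Import all_boot all_algebra.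
From mathcomp Require Import finmap monalg.

Set Implicit Arguments.
Unset Strict Implicit.
Unset Printing Implicit Defensive.

Import GRing.Theory.
Local Open Scope ring_scope.

(** * Linear extension of maps given on a basis *)

Section LinearExtension.
Variable k : fieldType.

(** Coefficients vanish outside the support, so extensions of several vectors can be compared on one
    common finite set. *)
Lemma linextEw (K : choiceType) (V : lmodType k) (f : K -> V) (d : {fset K}) x :
  (msupp x `<=` d)%fset -> linext f x = \sum_(a <- d) x@_a *: f a.
Proof.
move=> sub; rewrite /linext; apply/big_fset_incl => // a _.
by move/mcoeff_outdom ->; rewrite scale0r.
Qed.

Lemma linext_is_linear (K : choiceType) (V : lmodType k) (f : K -> V) :
  linear (linext f).
Proof.
move=> c x y; set d := (msupp x `|` msupp y `|` msupp (c *: x + y))%fset.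
rewrite !(@linextEw _ _ _ d) /d.
- rewrite scaler_sumr -big_split /=; apply: eq_bigr => a _.
  by rewrite mcoeffD mcoeffZ scalerDl scalerA.
- by rewrite fsubsetU // fsubsetUr.
- by rewrite fsubsetU // fsubsetUl.
- by rewrite fsubsetUr.
Qed.

HB.instance Definition _ (K : choiceType) (V : lmodType k) (f : K -> V) :=
  GRing.isLinear.Build k {malg k[K]} V *:%R (linext f) (linext_is_linear f).

Lemma linextU (K : choiceType) (V : lmodType k) (f : K -> V) a :
  linext f << a >> = f a.
Proof.
by rewrite (linextEw _ msuppU_le) big_seq_fset1 mcoeffUU scale1r.
Qed.

Lemma malgEU (K : choiceType) (x : {malg k[K]}) :
  x = \sum_(a <- msupp x) x@_a *: << a >>.
Proof.
rewrite {1}[x]monalgE; apply: eq_bigr => a _.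
by apply/malgP => b; rewrite mcoeffZ !mcoeffU mulrnAr mulr1.
Qed.

Lemma eq_linear_basis (K : choiceType) (V : lmodType k)
    (f g : {linear {malg k[K]} -> V}) :
  (forall a, f << a >> = g << a >>) -> f =1 g.
Proof.
move=> fg x; rewrite [x]malgEU !linear_sum; apply: eq_bigr => a _.
by rewrite !linearZ fg.
Qed.

Lemma eq_linext (K : choiceType) (V : lmodType k) (f g : K -> V) :
  f =1 g -> linext f =1 linext g.
Proof. by move=> fg x; apply: eq_bigr => a _; rewrite fg. Qed.

Lemma linext_comp (K : choiceType) (V W : lmodType k) (f : K -> V)
    (g : {linear V -> W}) x :
  g (linext f x) = linext (fun a => g (f a)) x.
Proof. by rewrite linear_sum; apply: eq_bigr => a _; rewrite linearZ. Qed.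

Lemma linext_id (K : choiceType) (x : {malg k[K]}) : linext (fun a => << a >>) x = x.
Proof. by rewrite /linext -malgEU. Qed.

Lemma linext_sumf (K : choiceType) (V : lmodType k) (I : Type) (r : seq I)
    (F : I -> K -> V) x :
  linext (fun a => \sum_(i <- r) F i a) x = \sum_(i <- r) linext (F i) x.
Proof.
rewrite /linext exchange_big /=; apply: eq_bigr => a _; exact: scaler_sumr.
Qed.

Lemma linextDf (K : choiceType) (V : lmodType k) (f g : K -> V) x :
  linext (fun a => f a + g a) x = linext f x + linext g x.
Proof.
by rewrite /linext -big_split; apply: eq_bigr => a _; rewrite scalerDr.
Qed.

Lemma linextNf (K : choiceType) (V : lmodType k) (f : K -> V) x :
  linext (fun a => - f a) x = - linext f x.
Proof.
by rewrite /linext -sumrN; apply: eq_bigr => a _; rewrite scalerN.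
Qed.

End LinearExtension.

(** * Grafting on words of trees and splitting of words *)

(* [grafts t w] and [wgrafts t X] list with multiplicity the terms of the left
   grafting of t on w and of its extension to words by the Leibniz rule;
   [splits X] lists those of the coshuffle coproduct of X. *)
Definition grafts (t w : otree) : seq otree := [seq graft_at t s w | s <- nodes w].

Fixpoint wgrafts (t : otree) (X : seq otree) : seq (seq otree) :=
  if X is w :: X' then
    [seq u :: X' | u <- grafts t w] ++ [seq w :: Z | Z <- wgrafts t X']
  else [::].

Fixpoint splits (T : Type) (X : seq T) : seq (seq T * seq T) :=
  if X is t :: X' then
    [seq (t :: p.1, p.2) | p <- splits X'] ++
    [seq (p.1, t :: p.2) | p <- splits X']
  else [:: ([::], [::])].

Lemma wgrafts_cons t w X :
  wgrafts t (w :: X) =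
    [seq u :: X | u <- grafts t w] ++ [seq w :: Z | Z <- wgrafts t X].
Proof. by []. Qed.

Lemma splits_cons (T : Type) (t : T) X :
  splits (t :: X) = [seq (t :: p.1, p.2) | p <- splits X] ++
                    [seq (p.1, t :: p.2) | p <- splits X].
Proof. by []. Qed.

Arguments wgrafts : simpl never.
Arguments splits : simpl never.

Section Words.
Variable V : zmodType.

Lemma big_splits_cons (T : Type) (F : seq T -> seq T -> V) t X :
  \sum_(p <- splits (t :: X)) F p.1 p.2 =
    \sum_(p <- splits X) (F (t :: p.1) p.2 + F p.1 (t :: p.2)).
Proof. by rewrite splits_cons big_cat !big_map big_split. Qed.

Lemma big_wgrafts_cons (F : seq otree -> V) t w X :
  \sum_(Z <- wgrafts t (w :: X)) F Z =
    \sum_(u <- grafts t w) F (u :: X) + \sum_(Z <- wgrafts t X) F (w :: Z).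
Proof. by rewrite wgrafts_cons big_cat !big_map. Qed.

Lemma big_wgrafts_cat (F : seq otree -> V) t X Y :
  \sum_(Z <- wgrafts t (X ++ Y)) F Z =
    \sum_(Z <- wgrafts t X) F (Z ++ Y) + \sum_(Z <- wgrafts t Y) F (X ++ Z).
Proof.
elim: X F => [|w X IH] F; first by rewrite big_nil add0r.
by rewrite cat_cons !big_wgrafts_cons IH addrA.
Qed.

(** Turns the indexed sum in the recursion of [rhd_tree] into a sum over the list [wgrafts]; the
    default [u0] is never reached. *)
Lemma big_wgrafts_ord (F : seq otree -> V) t u0 X :
  \sum_(i < size X) \sum_(u <- grafts t (nth u0 X i))
     F (take i X ++ u :: drop i.+1 X) = \sum_(Z <- wgrafts t X) F Z.
Proof.
elim: X F => [|w X IH] F; first by rewrite big_ord0 big_nil.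
by rewrite big_ord_recl big_wgrafts_cons /= drop0 -IH.
Qed.

Lemma size_wgrafts t X Z : Z \in wgrafts t X -> size Z = size X.
Proof.
elim: X Z => //= w X IH Z; rewrite mem_cat.
by case/orP=> /mapP[U U_in ->] //=; rewrite (IH _ U_in).
Qed.

Lemma size_splits (T : eqType) (X : seq T) p :
  p \in splits X -> (size p.1 + size p.2)%N = size X.
Proof.
elim: X p => [|t X IH] p /=; first by rewrite inE => /eqP ->.
by rewrite mem_cat => /orP[] /mapP[q /IH <- ->]; rewrite /= ?addnS.
Qed.

(* Grafting is a coderivation of the coshuffle coproduct. *)
Lemma big_splits_wgrafts (F : seq otree -> seq otree -> V) t X :
  \sum_(Z <- wgrafts t X) \sum_(p <- splits Z) F p.1 p.2 =
    \sum_(p <- splits X) (\sum_(a <- wgrafts t p.1) F a p.2 +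
                          \sum_(b <- wgrafts t p.2) F p.1 b).
Proof.
elim: X F => [|w X IH] F; first by rewrite big_nil big_seq1 !big_nil addr0.
rewrite big_wgrafts_cons.
under eq_bigr do rewrite big_splits_cons.
under [X in _ + X = _]eq_bigr do rewrite big_splits_cons.
rewrite (IH (fun a b => F (w :: a) b + F a (w :: b))) exchange_big -big_split /=.
rewrite (big_splits_cons (fun a b => \sum_(a' <- wgrafts t a) F a' b +
                                      \sum_(b' <- wgrafts t b) F a b')).
apply: eq_bigr => p _; rewrite !big_wgrafts_cons !big_split /=.
(* Of the six sums, 1, 3 and 5 have [w] in the left factor and 4, 2 and 6 have it in the right
   one. *)
by rewrite [LHS](AC (2*(2*2)) ((1*3*5)*(4*(2*6)))).
Qed.

(** Either way the first letter enters one of three factors, so the induction hypothesis is used for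
    the sum of these three variants of [F]. *)
Lemma big_splits_coassoc (T : Type) (F : seq T -> seq T -> seq T -> V) X :
  \sum_(p <- splits X) \sum_(q <- splits p.1) F q.1 q.2 p.2 =
  \sum_(p <- splits X) \sum_(q <- splits p.2) F p.1 q.1 q.2.
Proof.
elim: X F => [|t X IH] F; first by rewrite !big_seq1.
rewrite (big_splits_cons (fun a b => \sum_(q <- splits a) F q.1 q.2 b)).
rewrite (big_splits_cons (fun a b => \sum_(q <- splits b) F a q.1 q.2)) /=.
under [RHS]eq_bigr => p _.
  rewrite (big_splits_cons (fun b c => F p.1 b c)) -big_split /=.
  over.
rewrite -(IH (fun a b c => F (t :: a) b c + (F a (t :: b) c + F a b (t :: c)))).
apply: eq_bigr => p _ /=.
rewrite (big_splits_cons (fun a b => F a b p.2)) -big_split.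
by apply: eq_bigr => q _; rewrite addrA.
Qed.

Lemma big_splits_nil (T : eqType) (F : seq T -> seq T -> V) X :
  \sum_(p <- splits X | p.1 == [::]) F p.1 p.2 = F [::] X.
Proof.
elim: X F => [|t X IH] F; first by rewrite big_cons big_nil addr0.
rewrite splits_cons big_cat !big_map big_pred0 /=; last by case.
by rewrite add0r (IH (fun a b => F a (t :: b))).
Qed.

End Words.

Lemma splits_map (T U : Type) (f : T -> U) X :
  splits (map f X) = [seq (map f p.1, map f p.2) | p <- splits X].
Proof.
elim: X => //= t X IH; rewrite !splits_cons IH map_cat -4!map_comp.
by congr (_ ++ _); apply: eq_map.
Qed.

(* The terms of the coproduct other than 1 (x) X have a shorter second factor,
   so that a right convolution inverse is unique even for an action that is not
   known to be associative. *)
Lemma splits_convolution_inj (T : eqType) (V : zmodType) 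
    (op : seq T -> V -> V) (f g : seq T -> V) :
  (forall v, op [::] v = v) ->
  (forall X, \sum_(p <- splits X) op p.1 (f p.2) =
             \sum_(p <- splits X) op p.1 (g p.2)) ->
  f =1 g.
Proof.
move=> op0 fg X; have [n] := ubnP (size X); elim: n X => // n IH X leXn.
have := fg X.
rewrite (bigID (fun p => p.1 == [::])) [RHS](bigID (fun p => p.1 == [::])) /=.
rewrite (big_splits_nil (fun a b => op a (f b))).
rewrite (big_splits_nil (fun a b => op a (g b))) !op0.
rewrite [X in _ + X = _]big_seq_cond [X in _ = _ + X]big_seq_cond.
rewrite (eq_bigr (fun p => op p.1 (g p.2))); first by move/addIr.
move=> p /andP[/size_splits eqX p1]; rewrite IH // -ltnS.
by apply: leq_ltn_trans leXn; rewrite -eqX -add1n leq_add2r lt0n size_eq0.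
Qed.

(** * The action of words on words and its recursion in the first letter *)

(* The operations below are locked to keep unification from unfolding them into
   sums over supports. *)
HB.lock Definition wordU (k : fieldType) (X : seq otree) : {malg k[oforest]} :=
  << FMonom X >>.
Canonical wordU_unlock := Unlockable wordU.unlock.

HB.lock Definition graft_deriv (k : fieldType) (t : otree) (x : {malg k[oforest]}) :
    {malg k[oforest]} :=
  linext (fun X : oforest => \sum_(Z <- wgrafts t X) wordU k Z) x.
Canonical graft_deriv_unlock := Unlockable graft_deriv.unlock.

HB.lock Definition rhd_tree_word (k : fieldType) (X : seq otree) (w : otree) :
    {malg k[oforest]} := in_forests (rhd_tree k X w).
Canonical rhd_tree_word_unlock := Unlockable rhd_tree_word.unlock.

HB.lock Definition rhd_word (k : fieldType) (X Y : seq otree) : {malg k[oforest]} :=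
  rhd_forest k (FMonom X) Y.
Canonical rhd_word_unlock := Unlockable rhd_word.unlock.

HB.lock Definition rhdL (k : fieldType) (X : seq otree)
    (y : {malg k[oforest]}) : {malg k[oforest]} := rhd (wordU k X) y.
Canonical rhdL_unlock := Unlockable rhdL.unlock.

(** The algebra of the inductive step of [rhd_word_consl]: [t] acts on the first or on the second
    factor of a product, each time with its correction term. *)
Lemma leibniz_sumB (R : pzRingType) (I J : Type) (r : seq I) (s : seq J)
    (x y x' y' : R) (f : I -> R) (g : J -> R) :
  (x' - \sum_(i <- r) f i) * y + x * (y' - \sum_(j <- s) g j) =
  x' * y + x * y' - (\sum_(i <- r) f i * y + \sum_(j <- s) x * g j).
Proof. by rewrite mulrBl mulrBr mulr_suml mulr_sumr addrACA opprD. Qed.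

Section PostHopf.
Variable k : fieldType.
Local Notation wordU := (@wordU k).

Lemma malgUM (K : monomType) (a b : K) :
  << a >> * << b >> = << mmul a b >> :> {malg k[K]}.
Proof. by rewrite malgM_def (fgmulUU 1 1 a b) mulr1. Qed.

Lemma fmonomM (I : choiceType) (X Y : seq I) :
  mmul (FMonom X) (FMonom Y) = FMonom (X ++ Y).
Proof. exact: fmmulE. Qed.

Lemma wordU_cat X Y : wordU X * wordU Y = wordU (X ++ Y).
Proof.
by rewrite wordU.unlock malgUM fmonomM.
Qed.

Lemma wordU_nil : wordU [::] = 1.
Proof. by rewrite wordU.unlock -fmoneE. Qed.

Lemma eq_linear_words (V : lmodType k) (f g : {linear {malg k[oforest]} -> V}) :
  (forall X, f (wordU X) = g (wordU X)) -> f =1 g.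
Proof.
move=> fg; apply: eq_linear_basis => X.
by rewrite -(fmK X); move: (fg X); rewrite wordU.unlock.
Qed.

Lemma lgraftE t w : lgraft k t w = \sum_(u <- grafts t w) << u >>.
Proof. by rewrite /lgraft big_map. Qed.

Lemma coshuffle_forestE X :
  coshuffle_forest k (FMonom X) =
    \sum_(p <- splits X) << (FMonom p.1, FMonom p.2) >>.
Proof.
rewrite /coshuffle_forest /=; elim: X => [|t X IH].
  by rewrite big_nil big_seq1 /= -fmoneE.
rewrite big_cons IH splits_cons big_cat !big_map mulrDl.
congr (_ + _); rewrite mulr_sumr; apply: eq_bigr => p _ /=; rewrite malgUM;
  by rewrite /mmul /= /pair_mul /= fmonomM mul1m.
Qed.

Lemma coshuffleE X :
  coshuffle (wordU X) = \sum_(p <- splits X) << (FMonom p.1, FMonom p.2) >>.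
Proof. by rewrite /coshuffle wordU.unlock linextU coshuffle_forestE. Qed.

Local Notation graft_deriv := (@graft_deriv k).
Local Notation rhd_word := (@rhd_word k).
Local Notation rhd_tree_word := (@rhd_tree_word k).

Lemma graft_deriv_is_linear t : linear (graft_deriv t).
Proof. by rewrite unlock => c x y; rewrite linearP. Qed.

HB.instance Definition _ t :=
  GRing.isLinear.Build k {malg k[oforest]} {malg k[oforest]} *:%R (graft_deriv t)
    (graft_deriv_is_linear t).

Lemma graft_derivU t X : graft_deriv t (wordU X) = \sum_(Z <- wgrafts t X) wordU Z.
Proof. by rewrite unlock wordU.unlock linextU. Qed.

Lemma malgZU (K : choiceType) c d (a : K) :
  c *: << d *g a >> = << c * d *g a >> :> {malg k[K]}.
Proof. by apply/malgP => b; rewrite mcoeffZ !mcoeffU mulrnAr. Qed.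

Lemma malg_scalerAr (K : monomType) (c : k) (x y : {malg k[K]}) :
  x * (c *: y) = c *: (x * y).
Proof.
rewrite [y]monalgE [x]monalgE scaler_sumr !mulr_suml scaler_sumr.
apply: eq_bigr => a _; rewrite !mulr_sumr scaler_sumr.
apply: eq_bigr => b _.
by rewrite malgZU !malgM_def !fgmulUU malgZU mulrCA.
Qed.

Lemma mull_is_linear (K : monomType) (x : {malg k[K]}) :
  linear (fun y : {malg k[K]} => x * y).
Proof. by move=> c y z; rewrite mulrDr malg_scalerAr. Qed.

Lemma mulr_is_linear (K : monomType) (x : {malg k[K]}) :
  linear (fun y : {malg k[K]} => y * x).
Proof. by move=> c y z; rewrite mulrDl scalerAl. Qed.

(** Multiplication by a fixed element gets a name so that it can carry the linear structure required
    by [eq_linear_words]. *)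
Definition malg_mull (K : monomType) (x y : {malg k[K]}) : {malg k[K]} := x * y.
Definition malg_mulr (K : monomType) (x y : {malg k[K]}) : {malg k[K]} := y * x.

HB.instance Definition _ (K : monomType) x :=
  GRing.isLinear.Build k {malg k[K]} {malg k[K]} *:%R (malg_mull x) (@mull_is_linear K x).
HB.instance Definition _ (K : monomType) x :=
  GRing.isLinear.Build k {malg k[K]} {malg k[K]} *:%R (malg_mulr x) (@mulr_is_linear K x).

Lemma graft_deriv1 t : graft_deriv t 1 = 0.
Proof. by rewrite -wordU_nil graft_derivU big_nil. Qed.

Lemma graft_derivM t x y :
  graft_deriv t (x * y) = graft_deriv t x * y + x * graft_deriv t y.
Proof.
apply: (@eq_linear_words _ (graft_deriv t \o malg_mulr y)
  (malg_mulr y \o graft_deriv t \+ malg_mulr (graft_deriv t y))) => X /=.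
rewrite /malg_mulr; apply: (@eq_linear_words _ (graft_deriv t \o malg_mull (wordU X))
  (malg_mull (graft_deriv t (wordU X)) \+ (malg_mull (wordU X) \o graft_deriv t))) => Y /=.
rewrite /malg_mull wordU_cat !graft_derivU big_wgrafts_cat mulr_suml mulr_sumr.
by congr (_ + _); apply: eq_bigr => Z _; rewrite wordU_cat.
Qed.

Lemma in_forestsU t : in_forests (<< t >> : {malg k[otree]}) = wordU [:: t].
Proof. by rewrite /in_forests wordU.unlock linextU. Qed.

HB.instance Definition _ :=
  GRing.isLinear.Build k {malg k[otree]} {malg k[oforest]} *:%R
    (@in_forests k) (linext_is_linear (fun t => << tree_forest t >>)).

Lemma graft_deriv_in_forests t x :
  graft_deriv t (in_forests x) = in_forests (linext (lgraft k t) x).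
Proof.
apply: (eq_linear_basis (f := graft_deriv t \o @in_forests k)
   (g := @in_forests k \o linext (lgraft k t))) => w /=.
rewrite in_forestsU graft_derivU big_wgrafts_cons big_nil addr0.
rewrite linextU lgraftE linear_sum.
by apply: eq_bigr => u _; rewrite /= in_forestsU.
Qed.

Lemma rhd_tree_consE t X w :
  rhd_tree k (t :: X) w =
    linext (lgraft k t) (rhd_tree k X w) - \sum_(Z <- wgrafts t X) rhd_tree k Z w.
Proof.
rewrite rhd_tree_cons -(big_wgrafts_ord _ t t); congr (_ - _).
apply: eq_bigr => i _; rewrite lgraftE linear_sum.
by apply: eq_bigr => u _; rewrite /= linextU.
Qed.

Lemma rhd_tree_word_nil w : rhd_tree_word [::] w = wordU [:: w].
Proof. by rewrite unlock rhd_tree_nil in_forestsU. Qed.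

Lemma rhd_tree_word_cons t X w :
  rhd_tree_word (t :: X) w =
    graft_deriv t (rhd_tree_word X w) - \sum_(Z <- wgrafts t X) rhd_tree_word Z w.
Proof.
rewrite rhd_tree_word.unlock graft_deriv_in_forests rhd_tree_consE.
rewrite (linearB (@in_forests k)); congr (_ - _).
exact: (linear_sum (@in_forests k)).
Qed.

Lemma counit_wordU X : counit (wordU X) = (X == [::])%:R.
Proof. by rewrite wordU.unlock /counit mcoeffU1 -val_eqE /= fm1. Qed.

Lemma rhd_word_nilr X : rhd_word X [::] = (X == [::])%:R *: 1.
Proof.
by rewrite unlock -counit_wordU wordU.unlock.
Qed.

Lemma rhd_word_consr X w Y :
  rhd_word X (w :: Y) =
    \sum_(p <- splits X) rhd_tree_word p.1 w * rhd_word p.2 Y.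
Proof.
rewrite rhd_word.unlock rhd_tree_word.unlock /= coshuffle_forestE linear_sum.
by apply: eq_bigr => p _; rewrite /= linextU.
Qed.

Lemma rhd_word_nill Y : rhd_word [::] Y = wordU Y.
Proof.
elim: Y => [|w Y IH]; first by rewrite rhd_word_nilr scale1r wordU_nil.
by rewrite rhd_word_consr big_seq1 IH rhd_tree_word_nil wordU_cat.
Qed.

Lemma wgrafts_neq_nil t X Z : Z \in wgrafts t X -> Z != [::].
Proof. by case: X => // w X /size_wgrafts; rewrite -size_eq0 => ->. Qed.

(** On a single tree this is the recursion that defines [rhd_tree]. It passes to words because the
    action is multiplicative along the coproduct, while grafting [t] is a derivation of
    concatenation and a coderivation of the coproduct. *)
Lemma rhd_word_consl t X Y :
  rhd_word (t :: X) Y =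
    graft_deriv t (rhd_word X Y) - \sum_(Z <- wgrafts t X) rhd_word Z Y.
Proof.
elim: Y X => [|w Y IH] X.
  rewrite !rhd_word_nilr scale0r linearZ /= graft_deriv1 scaler0 big_seq big1 ?subr0 //.
  by move=> Z /wgrafts_neq_nil/negbTE Zn; rewrite rhd_word_nilr Zn scale0r.
rewrite !rhd_word_consr.
under [X in _ - X]eq_bigr do rewrite rhd_word_consr.
rewrite (big_splits_cons (fun a b => rhd_tree_word a w * rhd_word b Y)).
rewrite (big_splits_wgrafts (fun a b => rhd_tree_word a w * rhd_word b Y)).
rewrite linear_sum -sumrB; apply: eq_bigr => p _ /=.
rewrite graft_derivM.
rewrite rhd_tree_word_cons IH.
exact: leibniz_sumB.
Qed.

Local Notation rhdL := (@rhdL k).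

Lemma rhdLE X y : rhdL X y = linext (fun Y : oforest => rhd_word X Y) y.
Proof. by rewrite rhdL.unlock /rhd /bilinext wordU.unlock linextU rhd_word.unlock. Qed.

Lemma rhdL_wordU X Y : rhdL X (wordU Y) = rhd_word X Y.
Proof. by rewrite rhdLE wordU.unlock linextU. Qed.

Lemma rhdL_is_linear X : linear (rhdL X).
Proof. by move=> c y z; rewrite !rhdLE linearP. Qed.

HB.instance Definition _ X :=
  GRing.isLinear.Build k {malg k[oforest]} {malg k[oforest]} *:%R
    (rhdL X) (rhdL_is_linear X).

Lemma rhdL_nil y : rhdL [::] y = y.
Proof.
by apply: (@eq_linear_words _ (rhdL [::]) idfun) => Y /=; rewrite rhdL_wordU rhd_word_nill.
Qed.

Definition sum_lin (I : Type) (r : seq I) (V W : lmodType k)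
  (F : I -> {linear V -> W}) (x : V) : W := \sum_(i <- r) F i x.

Lemma sum_lin_is_linear (I : Type) (r : seq I) (V W : lmodType k)
    (F : I -> {linear V -> W}) : linear (sum_lin r F).
Proof.
move=> c x y; rewrite /sum_lin scaler_sumr -big_split.
by apply: eq_bigr => i _; rewrite linearP.
Qed.

HB.instance Definition _ (I : Type) (r : seq I) (V W : lmodType k)
    (F : I -> {linear V -> W}) :=
  GRing.isLinear.Build k V W *:%R (sum_lin r F) (sum_lin_is_linear r F).

Lemma rhdL_cons t X y :
  rhdL (t :: X) y = graft_deriv t (rhdL X y) - \sum_(Z <- wgrafts t X) rhdL Z y.
Proof.
apply: (@eq_linear_words _ (rhdL (t :: X))
  ((graft_deriv t \o rhdL X) \- sum_lin (wgrafts t X) (fun Z => rhdL Z))) => Y /=.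
rewrite /sum_lin !rhdL_wordU rhd_word_consl; congr (_ - _).
by apply: eq_bigr => Z _ /=; rewrite rhdL_wordU.
Qed.

End PostHopf.

(** * The product [circ], the black triangle product and the antipode *)

(** The recursions below lead from [t :: X] to graftings of [t] on [X], which are not [X] but have
    its length; hence induction on the length. *)
Lemma word_strong_ind (T : Type) (Q : seq T -> Prop) :
  (forall X, (forall Z, (size Z < size X)%N -> Q Z) -> Q X) -> forall X, Q X.
Proof.
move=> H X; have [n] := ubnP (size X); elim: n X => // n IH X leXn.
by apply: H => Z ltZX; apply: IH; apply: leq_trans ltZX _.
Qed.

Lemma eq_big_wgrafts (V : zmodType) t X (F G : seq otree -> V) :
  (forall Z, size Z = size X -> Z != [::] -> F Z = G Z) ->
  \sum_(Z <- wgrafts t X) F Z = \sum_(Z <- wgrafts t X) G Z.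
Proof.
move=> FG; rewrite !big_seq; apply: eq_bigr => Z Z_in.
by rewrite FG ?(size_wgrafts Z_in) ?(wgrafts_neq_nil Z_in).
Qed.

(* The value of (-1)^|X| S(X) |> Y for the antipode S of the product o: since
   tX = t o X - t |> X and S(t) = -t, one has S(tX) = - S(X) o t - S(t |> X). *)
Fixpoint btri_word_rec (k : fieldType) (n : nat) (X Y : seq otree) :
    {malg k[oforest]} :=
  match n, X with
  | n'.+1, t :: X' => \sum_(Z <- wgrafts t Y) btri_word_rec k n' X' Z +
                      \sum_(Z <- wgrafts t X') btri_word_rec k n' Z Y
  | _, _ => wordU k Y
  end.

HB.lock Definition btri_word (k : fieldType) (X Y : seq otree) : {malg k[oforest]} :=
  btri_word_rec k (size X) X Y.
Canonical btri_word_unlock := Unlockable btri_word.unlock.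

HB.lock Definition circL (k : fieldType) (X : seq otree)
    (y : {malg k[oforest]}) : {malg k[oforest]} := circ (wordU k X) y.
Canonical circL_unlock := Unlockable circL.unlock.

(** This identity and the next two isolate the algebra of the inductive steps of [btri_word_cat],
    [circL_cons] and [rhdL_btri_word]. *)
Lemma leibniz_sumD (R : pzRingType) (I J : Type) (r r' : seq I) (s s' : seq J)
    (x y : R) (f f' : I -> R) (g g' : J -> R) :
  \sum_(i <- r') f' i * y + \sum_(j <- s') x * g' j +
    (\sum_(i <- r) f i * y + \sum_(j <- s) x * g j) =
  (\sum_(i <- r') f' i + \sum_(i <- r) f i) * y +
    x * (\sum_(j <- s') g' j + \sum_(j <- s) g j).
Proof. by rewrite mulrDl mulrDr !mulr_suml !mulr_sumr addrACA. Qed.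

Lemma leibniz_sum_cancel (R : pzRingType) (I J : Type) (r : seq I) (s : seq J)
    (a x y y' : R) (f : I -> R) (g : J -> R) :
  a + x * (y' - \sum_(j <- s) g j) =
  a + ((\sum_(i <- r) f i) * y + x * y') -
    (\sum_(i <- r) f i * y + \sum_(j <- s) x * g j).
Proof.
rewrite mulrBr mulr_suml mulr_sumr opprD -[RHS]addrA; congr (_ + _).
by rewrite addrACA subrr add0r.
Qed.

Lemma scalerB_sumD (R : pzRingType) (V : lmodType R) (I J L : Type)
    (r : seq I) (s : seq J) (q : seq L) (c : R) (d : V)
    (f : I -> V) (g : J -> V) (h : L -> V) :
  c *: (d - \sum_(i <- r) f i) +
    (- c) *: (\sum_(j <- s) g j + \sum_(l <- q) h l) =
  c *: d - (\sum_(i <- r) c *: f i + \sum_(l <- q) c *: h l) -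
    \sum_(j <- s) c *: g j.
Proof.
rewrite scaleNr scalerBr scalerDr !scaler_sumr !opprD !addrA.
by rewrite [LHS](ACl (1*2*4*3)).
Qed.

Section Antipode.
Variable k : fieldType.
Local Notation wordU := (@wordU k).
Local Notation circL := (@circL k).
Local Notation btri_word := (@btri_word k).
Local Notation rhdL := (@rhdL k).
Local Notation graft_deriv := (@graft_deriv k).

Implicit Types (x y z : {malg k[oforest]}) (X Y Z : seq otree) (t : otree).

Lemma btri_word_nill Y : btri_word [::] Y = wordU Y.
Proof. by rewrite unlock. Qed.

Lemma btri_word_cons t X Y :
  btri_word (t :: X) Y =
    \sum_(Z <- wgrafts t Y) btri_word X Z +
    \sum_(Z <- wgrafts t X) btri_word Z Y.
Proof.
rewrite btri_word.unlock /=; congr (_ + _).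
by apply: eq_big_wgrafts => Z ->.
Qed.

Lemma btri_word_nilr X : btri_word X [::] = (X == [::])%:R *: 1.
Proof.
elim/word_strong_ind: X => [[|t X]] IH.
  by rewrite btri_word_nill scale1r wordU_nil.
rewrite btri_word_cons big_nil add0r scale0r.
rewrite (@eq_big_wgrafts _ _ _ _ (fun=> 0)) ?big1 //.
by move=> Z sZ /negbTE Zn; rewrite IH ?sZ // Zn scale0r.
Qed.

(** In the recursion for [t :: X], the graftings on [Y ++ Z] separate by the Leibniz rule and those
    on [X] by the coderivation rule. The four resulting sums are the expansions of the terms where
    [t] joins the left or the right part of the splitting. *)
Lemma btri_word_cat X Y Z :
  btri_word X (Y ++ Z) = \sum_(p <- splits X) btri_word p.1 Y * btri_word p.2 Z.
Proof.
elim/word_strong_ind: X Y Z => [[|t X]] IH Y Z.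
  by rewrite big_seq1 !btri_word_nill wordU_cat.
rewrite btri_word_cons big_wgrafts_cat.
rewrite (big_splits_cons (fun a b => btri_word a Y * btri_word b Z)).
pose G a b := btri_word a Y * btri_word b Z.
rewrite (@eq_big_wgrafts _ t X _
  (fun W => \sum_(p <- splits W) G p.1 p.2)); last first.
  by move=> W sW _; rewrite IH // sW.
rewrite (big_splits_wgrafts G).
under eq_bigr do rewrite IH //.
under [X in _ + X + _]eq_bigr do rewrite IH //.
rewrite exchange_big [X in _ + X + _]exchange_big -!big_split /=.
apply: eq_bigr => p _; rewrite !btri_word_cons.
exact: leibniz_sumD.
Qed.

Lemma rhdLD X y z : rhdL X (y + z) = rhdL X y + rhdL X z.
Proof. exact: linearD. Qed.

Lemma rhdL_sum X (I : Type) (r : seq I) (F : I -> {malg k[oforest]}) :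
  rhdL X (\sum_(i <- r) F i) = \sum_(i <- r) rhdL X (F i).
Proof. exact: (linear_sum (rhdL X)). Qed.

Lemma rhdLZ X c y : rhdL X (c *: y) = c *: rhdL X y.
Proof. exact: linearZ. Qed.

Lemma graft_derivZ t c x : graft_deriv t (c *: x) = c *: graft_deriv t x.
Proof. exact: linearZ. Qed.

Lemma graft_deriv_sum t (I : Type) (r : seq I) (F : I -> {malg k[oforest]}) :
  graft_deriv t (\sum_(i <- r) F i) = \sum_(i <- r) graft_deriv t (F i).
Proof. exact: (linear_sum (graft_deriv t)). Qed.

Lemma rhdL_btri_word X Y :
  \sum_(p <- splits X) (-1) ^+ size p.2 *: rhdL p.1 (btri_word p.2 Y) =
    (X == [::])%:R *: wordU Y.
Proof.
elim/word_strong_ind: X Y => [[|t X]] IH Y.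
  by rewrite big_seq1 rhdL_nil btri_word_nill !scale1r.
rewrite scale0r.
rewrite (big_splits_cons (fun a b => (-1) ^+ size b *: rhdL a (btri_word b Y))).
pose G a b := (-1) ^+ size b *: rhdL a (btri_word b Y).
(* Expanding both recursions leaves four kinds of terms. Grafting [t] inside either part of the
   splitting gives the same sum for the graftings of [t] on [X], which vanishes by induction. The
   other two are grafting [t] after and before the sum for [X]; they agree because that sum is a
   multiple of the identity. *)
transitivity (graft_deriv t (\sum_(p <- splits X) G p.1 p.2)
  - \sum_(Z <- wgrafts t X) \sum_(p <- splits Z) G p.1 p.2
  - \sum_(Z <- wgrafts t Y) \sum_(p <- splits X)
       (-1) ^+ size p.2 *: rhdL p.1 (btri_word p.2 Z)).
  rewrite (big_splits_wgrafts G) exchange_big graft_deriv_sum -!sumrB /=.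
  apply: eq_bigr => p _; rewrite (@eq_big_wgrafts _ t p.2 (G p.1)
    (fun b => (-1) ^+ size p.2 *: rhdL p.1 (btri_word b Y))); last first.
    by move=> b sb _; rewrite /G sb.
  rewrite {}/G rhdL_cons btri_word_cons exprS mulN1r graft_derivZ rhdLD !rhdL_sum.
  exact: scalerB_sumD.
rewrite [X in graft_deriv t X](IH X (ltnSn _) Y).
have -> : \sum_(Z <- wgrafts t X) \sum_(p <- splits Z) G p.1 p.2 = 0.
  rewrite (@eq_big_wgrafts _ t X _ (fun=> 0)) ?big1_eq // => Z sZ /negbTE Zn.
  by rewrite IH ?sZ // Zn scale0r.
have -> : \sum_(Z <- wgrafts t Y) \sum_(p <- splits X)
    (-1) ^+ size p.2 *: rhdL p.1 (btri_word p.2 Z) =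
    \sum_(Z <- wgrafts t Y) (X == [::])%:R *: wordU Z.
  by apply: eq_bigr => Z _; apply: IH.
by rewrite graft_derivZ graft_derivU scaler_sumr subr0 subrr.
Qed.

Lemma circLE X y :
  circL X y = \sum_(p <- splits X) wordU p.1 * rhdL p.2 y.
Proof.
rewrite circL.unlock /circ coshuffleE linear_sum; apply: eq_bigr => p _.
by rewrite rhdL.unlock wordU.unlock; apply: linextU.
Qed.

Lemma circL_nil y : circL [::] y = y.
Proof. by rewrite circLE big_seq1 rhdL_nil wordU_nil mul1r. Qed.

(** This reflects that [t :: X] is the [circ]-product of [t] and [X] minus the graftings of [t] on
    [X]. By the Leibniz rule, the graftings on the left part of a splitting cancel, and [rhdL_cons]
    accounts for the rest. *)
Lemma circL_cons t X y :
  circL (t :: X) y = wordU [:: t] * circL X y + graft_deriv t (circL X y)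
    - \sum_(Z <- wgrafts t X) circL Z y.
Proof.
have E1 : wordU [:: t] * circL X y =
    \sum_(p <- splits X) wordU (t :: p.1) * rhdL p.2 y.
  by rewrite circLE mulr_sumr; apply: eq_bigr => p _; rewrite mulrA wordU_cat.
have E2 : graft_deriv t (circL X y) = \sum_(p <- splits X)
    ((\sum_(a <- wgrafts t p.1) wordU a) * rhdL p.2 y +
     wordU p.1 * graft_deriv t (rhdL p.2 y)).
  rewrite circLE graft_deriv_sum; apply: eq_bigr => p _.
  by rewrite graft_derivM graft_derivU.
have E3 : \sum_(Z <- wgrafts t X) circL Z y = \sum_(p <- splits X)
    (\sum_(a <- wgrafts t p.1) wordU a * rhdL p.2 y +
     \sum_(b <- wgrafts t p.2) wordU p.1 * rhdL b y).
  rewrite -(big_splits_wgrafts (fun a b => wordU a * rhdL b y)).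
  by apply: eq_bigr => Z _; apply: circLE.
rewrite {}E1 {}E2 {}E3 circLE (big_splits_cons (fun a b => wordU a * rhdL b y)).
rewrite -big_split -sumrB; apply: eq_bigr => p _; rewrite rhdL_cons.
exact: leibniz_sum_cancel.
Qed.

Lemma rhd_wordU X z : rhd (wordU X) z = rhdL X z.
Proof. by rewrite rhdL.unlock. Qed.

Lemma rhd_suml (I : Type) (r : seq I) (F : I -> {malg k[oforest]}) z :
  rhd (\sum_(i <- r) F i) z = \sum_(i <- r) rhd (F i) z.
Proof. exact: (linear_sum (linext _)). Qed.

Lemma rhdDl x y z : rhd (x + y) z = rhd x z + rhd y z.
Proof. exact: (linearD (linext _)). Qed.

Lemma rhdBl x y z : rhd (x - y) z = rhd x z - rhd y z.
Proof. exact: (linearB (linext _)). Qed.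

Lemma rhdZl c x z : rhd (c *: x) z = c *: rhd x z.
Proof. exact: (linearZ_LR (linext _)). Qed.

Lemma rhd1l z : rhd 1 z = z.
Proof. by rewrite -wordU_nil rhd_wordU rhdL_nil. Qed.

(** The left argument is the [circ]-product of [t] and [x], so this is the action law for a single
    tree: [rhdL_cons] with its correction term moved to the other side. *)
Lemma rhd_mul_graft_deriv t x z :
  rhd (wordU [:: t] * x + graft_deriv t x) z = graft_deriv t (rhd x z).
Proof.
pose R : {linear {malg k[oforest]} -> {malg k[oforest]}} :=
  linext (fun X : oforest => linext (fun Y : oforest => rhd_forest k X Y) z).
apply: (@eq_linear_words _ _ (R \o (malg_mull (wordU [:: t]) \+ graft_deriv t))
                         (graft_deriv t \o R)) => X.
change (rhd (wordU [:: t] * wordU X + graft_deriv t (wordU X)) z =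
        graft_deriv t (rhd (wordU X) z)).
rewrite wordU_cat graft_derivU rhdDl rhd_suml !rhd_wordU rhdL_cons.
have -> : \sum_(Z <- wgrafts t X) rhd (wordU Z) z =
          \sum_(Z <- wgrafts t X) rhdL Z z.
  by apply: eq_bigr => Z _; apply: rhd_wordU.
by rewrite subrK.
Qed.

(** The action law for [circ]: by [circL_cons] and [rhd_mul_graft_deriv], the left side obeys the
    recursion [rhdL_cons] of the right side. *)
Lemma rhd_circL X y z : rhd (circL X y) z = rhdL X (rhd y z).
Proof.
elim/word_strong_ind: X => [[|t X]] IH; first by rewrite circL_nil rhdL_nil.
rewrite circL_cons rhdBl rhd_mul_graft_deriv rhd_suml rhdL_cons IH //.
by rewrite (@eq_big_wgrafts _ _ _ _ (fun Z => rhdL Z (rhd y z))) // => Z sZ _;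
   rewrite IH ?sZ.
Qed.

(** Signed reversal is the antipode of the tensor algebra with the coshuffle coproduct. *)
Lemma sum_cat_rev X :
  \sum_(p <- splits X) (-1) ^+ size p.2 *: wordU (p.1 ++ rev p.2) =
    (X == [::])%:R *: 1.
Proof.
(* The suffix [W] absorbs the letter [t] of the right part, since [rev (t :: p.2) ++ W] is
   [rev p.2 ++ t :: W]. The two halves of the sum are then opposite multiples of
   [wordU (t :: W)]. *)
suff H W : \sum_(p <- splits X) (-1) ^+ size p.2 *: wordU (p.1 ++ rev p.2 ++ W) =
    (X == [::])%:R *: wordU W.
  rewrite -wordU_nil -(H [::]); apply: eq_bigr => p _.
  by rewrite cats0.
elim: X => [|t X IH] in W *.
  by rewrite big_seq1 !scale1r.
rewrite (big_splits_cons (fun a b => (-1) ^+ size b *: wordU (a ++ rev b ++ W))).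
have E1 : \sum_(p <- splits X)
      (-1) ^+ size p.2 *: wordU (t :: p.1 ++ rev p.2 ++ W) =
    (X == [::])%:R *: wordU (t :: W).
  have -> : wordU (t :: W) = wordU [:: t] * wordU W by rewrite wordU_cat.
  rewrite -malg_scalerAr -IH mulr_sumr; apply: eq_bigr => p _.
  by rewrite malg_scalerAr wordU_cat.
have E2 : \sum_(p <- splits X)
      (-1) ^+ size (t :: p.2) *: wordU (p.1 ++ rev (t :: p.2) ++ W) =
    - ((X == [::])%:R *: wordU (t :: W)).
  rewrite -IH -sumrN; apply: eq_bigr => p _.
  by rewrite /= exprS mulN1r scaleNr rev_cons cat_rcons.
rewrite big_split [RHS]scale0r; apply: etrans (congr2 +%R E1 E2) _.
exact: subrr.
Qed.

(* S(X) = S(X_1) |> (the antipode of X_2 in the tensor algebra); the signs of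
   the two factors combine to (-1)^|X|. *)
Definition antipode_word X : {malg k[oforest]} :=
  (-1) ^+ size X *: \sum_(p <- splits X) btri_word p.1 (rev p.2).

(** By coassociativity the action meets its convolution inverse from [rhdL_btri_word], and only the
    signed reversal of the whole word survives. *)
Lemma rhdL_antipode_word X :
  \sum_(p <- splits X) rhdL p.1 (antipode_word p.2) = (-1) ^+ size X *: wordU (rev X).
Proof.
pose F a b c := (-1) ^+ size c *: ((-1) ^+ size b *: rhdL a (btri_word b (rev c))).
transitivity (\sum_(p <- splits X) \sum_(q <- splits p.2) F p.1 q.1 q.2).
  apply: eq_bigr => p _; rewrite /antipode_word rhdLZ rhdL_sum scaler_sumr.
  rewrite [LHS]big_seq [RHS]big_seq.
  apply: eq_bigr => q /size_splits sq.
  by rewrite /F scalerA -exprD addnC sq.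
rewrite -big_splits_coassoc.
rewrite -[RHS](big_splits_nil (fun a b => (-1) ^+ size b *: wordU (rev b))).
rewrite [RHS]big_mkcond; apply: eq_bigr => p _.
have -> : \sum_(q <- splits p.1) F q.1 q.2 p.2 =
    (-1) ^+ size p.2 *: ((p.1 == [::])%:R *: wordU (rev p.2)).
  by rewrite -rhdL_btri_word scaler_sumr.
by case: eqP => _; rewrite ?scale1r ?scale0r ?scaler0.
Qed.

(** After coassociativity, [rhdL_antipode_word] leaves the convolution of the identity with signed
    reversal, which is [sum_cat_rev]. *)
Lemma circL_antipode_word X :
  \sum_(p <- splits X) circL p.1 (antipode_word p.2) = (X == [::])%:R *: 1.
Proof.
transitivity (\sum_(p <- splits X) \sum_(q <- splits p.1)
                wordU q.1 * rhdL q.2 (antipode_word p.2)).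
  by apply: eq_bigr => p _; rewrite circLE.
rewrite (big_splits_coassoc (fun a b c => wordU a * rhdL b (antipode_word c))).
rewrite -sum_cat_rev; apply: eq_bigr => p _.
by rewrite -mulr_sumr rhdL_antipode_word malg_scalerAr wordU_cat.
Qed.

Section WithAntipode.
Variable S : {linear {malg k[oforest]} -> {malg k[oforest]}}.
Hypothesis S_antipode : is_rhd_antipode S.

Lemma rhd_antipodeE X :
  \sum_(p <- splits X) circL p.1 (S (wordU p.2)) = (X == [::])%:R *: 1.
Proof.
have [_] := S_antipode (wordU X); rewrite /convolution coshuffleE => e.
rewrite -counit_wordU -{}e linear_sum; apply: eq_bigr => p _.
by rewrite circL.unlock wordU.unlock; apply/esym; apply: linextU.
Qed.

(** Both sides are right convolution inverses of the action evaluated at [Y]: the left one by the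
    action law [rhd_circL], the right one by [rhdL_btri_word]. *)
Lemma rhd_antipode X Y :
  rhd (S (wordU X)) (wordU Y) = (-1) ^+ size X *: btri_word X Y.
Proof.
move: X; apply: (splits_convolution_inj (op := rhdL)) => [v|X].
  exact: rhdL_nil.
transitivity ((X == [::])%:R *: wordU Y).
  rewrite -[wordU Y in RHS]rhd1l -rhdZl -rhd_antipodeE rhd_suml.
  by apply: eq_bigr => p _; rewrite rhd_circL.
by rewrite -rhdL_btri_word; apply: eq_bigr => p _; rewrite rhdLZ.
Qed.

Lemma btri_tree X w :
  btri S << FMonom X >> << tree_forest w >> = btri_word X [:: w].
Proof.
rewrite /btri /bilinext !linextU.
have := rhd_antipode X [:: w]; rewrite wordU.unlock /fdeg => ->.
(* The sign in the definition of [btri] cancels the one from [rhd_antipode]. *)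
by rewrite scalerA -exprD addnn -signr_odd odd_double scale1r.
Qed.

End WithAntipode.

End Antipode.

(** * Node addresses and grafting on the old nodes only *)

(** [forest_nodes] and [update_child] are named copies of the local fixpoints in [nodes] and
    [graft_at], which makes induction on the list of children possible. *)
Fixpoint forest_nodes (f : seq otree) : seq (seq nat) :=
  if f is t :: f' then [seq size f' :: s | s <- nodes t] ++ forest_nodes f'
  else [::].

Fixpoint update_child (g : otree -> otree) (i : nat) (f : seq otree) : seq otree :=
  if f is u :: f' then
    if size f' == i then g u :: f' else u :: update_child g i f'
  else [::].

Lemma nodes_Node f : nodes (Node f) = [::] :: forest_nodes f.
Proof. by rewrite /=; congr cons; elim: f => //= t f ->. Qed.

Lemma graft_at_nil t f : graft_at t [::] (Node f) = Node (t :: f).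
Proof. by []. Qed.

Lemma graft_at_cons t i s f :
  graft_at t (i :: s) (Node f) = Node (update_child (graft_at t s) i f).
Proof. by rewrite /=; congr Node; elim: f => //= u f ->. Qed.

Lemma size_update_child g i f : size (update_child g i f) = size f.
Proof. by elim: f => //= u f IH; case: eqP => //= _; rewrite IH. Qed.

Lemma update_child_cat g f1 u f2 :
  update_child g (size f2) (f1 ++ u :: f2) = f1 ++ g u :: f2.
Proof.
elim: f1 => [|v f1 IH] /=; first by rewrite eqxx.
by rewrite size_cat /= addnS gtn_eqF ?IH // ltnS leq_addl.
Qed.

Lemma update_childC g h i j f : i != j ->
  update_child g i (update_child h j f) =
  update_child h j (update_child g i f).
Proof.
move=> ij; elim: f => //= u f IH.
case: (eqVneq (size f) i) => [fi|fi] /=; case: (eqVneq (size f) j) => [fj|fj] /=;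
  rewrite ?size_update_child ?(negbTE fi) ?(negbTE fj) ?fi ?fj ?eqxx ?IH //.
by rewrite -fi fj eqxx in ij.
Qed.

Lemma forest_nodes_lt i s f : i :: s \in forest_nodes f -> (i < size f)%N.
Proof.
elim: f => //= u f IH; rewrite mem_cat => /orP[/mapP[r _ [-> _]] //|/IH].
exact: ltnW.
Qed.

Lemma nil_forest_nodes f : [::] \notin forest_nodes f.
Proof.
by elim: f => //= u f IH; rewrite mem_cat negb_or IH andbT; apply/mapP => -[].
Qed.

Lemma forest_nodesP s f : s \in forest_nodes f -> exists f1 u f2 r,
  [/\ f = f1 ++ u :: f2, s = size f2 :: r & r \in nodes u].
Proof.
elim: f => //= u f IH; rewrite mem_cat => /orP[/mapP[r r_in ->]|/IH].
  by exists [::], u, f, r.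
by move=> [f1 [v [f2 [r [-> -> r_in]]]]]; exists (u :: f1), v, f2, r.
Qed.

Lemma mem_forest_nodes_cat f1 u f2 r :
  (size f2 :: r \in forest_nodes (f1 ++ u :: f2)) = (r \in nodes u).
Proof.
elim: f1 => [|v f1 IH] /=; rewrite mem_cat.
  rewrite mem_map => [|x y []//]; case: (r \in _) => //=.
  by apply/negP => /forest_nodes_lt; rewrite ltnn.
rewrite IH; case: (r \in nodes u); first by rewrite orbT.
rewrite orbF; apply/mapP => -[q _ [e _]]; move: e.
by rewrite size_cat /= addnS => /eqP; rewrite ltn_eqF // ltnS leq_addl.
Qed.

Lemma uniq_nodes w : uniq (nodes w).
Proof.
elim: w => f IH; rewrite nodes_Node cons_uniq nil_forest_nodes /=.
elim: f IH => //= u f IHf [u_uniq /IHf f_uniq].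
rewrite cat_uniq f_uniq map_inj_uniq ?u_uniq ?andbT => [|x y []//].
apply/hasPn => s s_in; apply/mapP => -[r _ e].
by move: s_in; rewrite e => /forest_nodes_lt; rewrite ltnn.
Qed.

Lemma perm_forest_nodes f1 u v f2 A : perm_eq (nodes v) (nodes u ++ A) ->
  perm_eq (forest_nodes (f1 ++ v :: f2))
          (forest_nodes (f1 ++ u :: f2) ++ [seq size f2 :: r | r <- A]).
Proof.
move=> uv; elim: f1 => [|x f1 IH] /=.
  apply: perm_trans (_ : perm_eq _ ([seq size f2 :: r | r <- nodes u ++ A]
                                    ++ forest_nodes f2)) _.
    by rewrite perm_cat2r perm_map.
  by rewrite map_cat -!catA perm_cat2l perm_catC.
by rewrite -catA !size_cat perm_cat2l.
Qed.

(** Here [a] is the address that the root of the grafted tree receives; it depends on [s] and [z]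
    but not on [x]. *)
Lemma nodes_graft_at s z : s \in nodes z -> exists a,
  forall x, perm_eq (nodes (graft_at x s z)) (nodes z ++ [seq a ++ r | r <- nodes x])
  /\ forall t r, graft_at t (a ++ r) (graft_at x s z) =
                 graft_at (graft_at t r x) s z.
Proof.
elim: s z => [|i s IH] [f].
  (* The new leftmost child has [size f] siblings to its right. *)
  move=> _; exists [:: size f] => x; split=> [|t r]; last first.
    by rewrite [LHS]graft_at_cons /= eqxx.
  rewrite [graft_at _ _ _]/= !nodes_Node /= perm_cons.
  by rewrite perm_catC.
rewrite nodes_Node inE => /forest_nodesP[f1 [u [f2 [r [-> [-> <-] r_in]]]]].
have [a Ha] := IH _ r_in; exists (size f2 :: a) => x.
have [perm_a graft_a] := Ha x; rewrite !graft_at_cons !update_child_cat; split=> [|t q].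
  rewrite !nodes_Node /= perm_cons; apply: perm_trans (perm_forest_nodes _ _ perm_a) _.
  by rewrite perm_cat2l -map_comp.
by rewrite cat_cons !graft_at_cons !update_child_cat graft_a.
Qed.

(** Old addresses stay valid, so both sides make sense. If one node is a root, the new child on the
    far left does not disturb the numbering; inside one child the induction applies, and distinct
    children are updated independently. *)
Lemma graft_atC t x r s z : r \in nodes z -> s \in nodes z -> r != s ->
  graft_at t r (graft_at x s z) = graft_at x s (graft_at t r z).
Proof.
elim: s r z => [|i s IH] [|j r] [f] //.
- rewrite nodes_Node inE => /forest_nodesP[f1 [u [f2 [q [-> [-> ->] q_in]]]]] _ _.
  rewrite (graft_at_cons t _ _ (_ ++ _)) !graft_at_nil graft_at_cons.
  by rewrite -cat_cons !update_child_cat.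
- move=> _; rewrite nodes_Node inE => /forest_nodesP[f1 [u [f2 [q [-> [-> ->] q_in]]]]] _.
  rewrite (graft_at_cons x _ _ (_ ++ _)) !graft_at_nil graft_at_cons.
  by rewrite -cat_cons !update_child_cat.
rewrite nodes_Node !inE => r_in /forest_nodesP[f1 [u [f2 [q [ef [-> <-] q_in]]]]].
move: r_in; rewrite {}ef; have [->|ji] := eqVneq j (size f2).
  rewrite mem_forest_nodes_cat => r_in; rewrite eqseq_cons eqxx andTb => rq.
  rewrite (graft_at_cons t _ _ (_ ++ _)) (graft_at_cons x _ _ (_ ++ _)).
  rewrite !update_child_cat.
  by rewrite !graft_at_cons !update_child_cat IH.
move=> _ _; rewrite (graft_at_cons t _ _ (_ ++ _)) (graft_at_cons x _ _ (_ ++ _)).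
by rewrite !graft_at_cons update_childC.
Qed.

(** The list [N] stays fixed while the tree grows: with [N] equal to [nodes w] it keeps designating
    the nodes of [w], by stability of addresses. *)
Definition grafts_on (N : seq (seq nat)) (X : seq otree) (w : otree) : seq otree :=
  foldr (fun u zs => [seq graft_at u s z | z <- zs, s <- N]) [:: w] X.

Lemma big_grafts_on_cons (V : zmodType) N t X w (F : otree -> V) :
  \sum_(z <- grafts_on N (t :: X) w) F z =
    \sum_(z <- grafts_on N X w) \sum_(s <- N) F (graft_at t s z).
Proof. by rewrite /= big_allpairs_dep. Qed.

Lemma sub_nodes_grafts_on N X w z : {subset N <= nodes w} ->
  z \in grafts_on N X w -> {subset N <= nodes z}.
Proof.
move=> Nw; elim: X z => [|x X IH] z /=; first by rewrite inE => /eqP ->.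
case/allpairsPdep=> y [s [y_in s_in ->]] r r_in.
have [a Ha] := nodes_graft_at (IH _ y_in _ s_in).
by rewrite (perm_mem (Ha x).1) mem_cat (IH _ y_in _ r_in).
Qed.

Lemma big_nodes_split (V : zmodType) N z (F : seq nat -> V) :
  uniq N -> {subset N <= nodes z} ->
  \sum_(r <- nodes z) F r =
    \sum_(r <- N) F r + \sum_(r <- nodes z | r \notin N) F r.
Proof.
move=> uN Nz; rewrite (bigID (mem N)) /=; congr (_ + _).
rewrite -big_filter; apply: perm_big; apply: uniq_perm => //.
  by rewrite filter_uniq ?uniq_nodes.
by move=> r; rewrite mem_filter; apply: andb_idr; apply: Nz.
Qed.

(* The addresses outside of w are those of the grafted trees, so grafting t
   there amounts to grafting it first on one of the trees of X. *)
Lemma big_grafts_on_outside (V : zmodType) t X w (F : otree -> V) :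
  let N := nodes w in
  \sum_(z <- grafts_on N X w) \sum_(r <- nodes z | r \notin N) F (graft_at t r z)
  = \sum_(Z <- wgrafts t X) \sum_(z <- grafts_on N Z w) F z.
Proof.
move=> N; elim: X F => [|x X IH] F.
  rewrite big_seq1 big_nil big_seq_cond big_pred0 // => r.
  by case: (r \in N).
rewrite big_grafts_on_cons big_wgrafts_cons.
under [X in _ = X + _]eq_bigr do rewrite big_grafts_on_cons.
under [X in _ = _ + X]eq_bigr do rewrite big_grafts_on_cons.
rewrite -(IH (fun z => \sum_(s <- N) F (graft_at x s z))).
rewrite [X in _ = X + _]exchange_big -big_split /=.
rewrite [LHS]big_seq [RHS]big_seq; apply: eq_bigr => z z_in.
have Nz := sub_nodes_grafts_on (fun _ => id) z_in.
rewrite [X in _ = X + _]exchange_big [X in _ = _ + X]exchange_big -big_split /=.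
rewrite [LHS]big_seq [RHS]big_seq.
apply: eq_bigr => s s_in; have [a /(_ x)[Hp Hg]] := nodes_graft_at (Nz _ s_in).
(* The nodes after grafting [x] are those of the copy of [x], where grafting [t] means grafting it
   on [x] beforehand, and those of [z], where outside [N] the two graftings commute. *)
rewrite (perm_big _ Hp) big_cat /= addrC; congr (_ + _).
  rewrite !big_map big_mkcond [LHS]big_seq [RHS]big_seq; apply: eq_bigr => r r_in.
  rewrite Hg; case: ifP => // /negbFE aN.
  (* If [a ++ r] were in [N], it would address both a node of [z] and a node of the copy of [x],
     against distinctness of addresses. *)
  have := uniq_nodes (graft_at x s z); rewrite (perm_uniq Hp) cat_uniq.
  by case/and3P=> _ /hasPn/(_ (a ++ r)); rewrite map_f // => /(_ isT); rewrite /= Nz.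
rewrite big_seq_cond [RHS]big_seq_cond; apply: eq_bigr => r /andP[r_in rN].
rewrite graft_atC //; first exact: Nz.
by apply: contraNneq rN => ->.
Qed.

(** Grafting on the nodes of [w] only is grafting on all nodes minus grafting on the other ones,
    which [big_grafts_on_outside] evaluates. *)
Lemma big_grafts_on_wgrafts (V : zmodType) t X w (F : otree -> V) :
  let N := nodes w in
  \sum_(z <- grafts_on N (t :: X) w) F z =
    \sum_(z <- grafts_on N X w) \sum_(u <- grafts t z) F u -
    \sum_(Z <- wgrafts t X) \sum_(z <- grafts_on N Z w) F z.
Proof.
move=> N; rewrite -big_grafts_on_outside big_grafts_on_cons -sumrB.
rewrite [LHS]big_seq [RHS]big_seq; apply: eq_bigr => z z_in.
rewrite big_map (@big_nodes_split _ N z) ?uniq_nodes ?addrK //.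
exact: (sub_nodes_grafts_on (fun _ => id) z_in).
Qed.

(** * The Grossman-Larson product and [Bplus] *)

HB.lock Definition GLmulL (k : fieldType) (X : seq otree) (w : otree) :
    {malg k[otree]} := GLmul_tree k (Node X) w.
Canonical GLmulL_unlock := Unlockable GLmulL.unlock.

Section GrossmanLarson.
Variable k : fieldType.
Local Notation wordU := (@wordU k).
Local Notation circL := (@circL k).
Local Notation graft_deriv := (@graft_deriv k).
Local Notation GLmulL := (@GLmulL k).

Lemma GLmulLE X w : GLmulL X w = \sum_(z <- grafts_on (nodes w) X w) << z >>.
Proof.
rewrite unlock /GLmul_tree /=; elim: X => [|x X IH] /=; first by rewrite big_seq1.
rewrite IH big_allpairs_dep linear_sum; apply: eq_bigr => z _.
exact: linextU.
Qed.

Lemma GLmulL_nil w : GLmulL [::] w = << w >>.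
Proof. by rewrite GLmulLE big_seq1. Qed.

(* The recursion that defines [rhd_tree], now for grafting on the nodes of w. *)
Lemma GLmulL_cons t X w :
  GLmulL (t :: X) w =
    linext (lgraft k t) (GLmulL X w) - \sum_(Z <- wgrafts t X) GLmulL Z w.
Proof.
have -> : linext (lgraft k t) (GLmulL X w) =
    \sum_(z <- grafts_on (nodes w) X w) \sum_(u <- grafts t z) << u >>.
  rewrite GLmulLE linear_sum; apply: eq_bigr => z _.
  by rewrite -lgraftE; apply: linextU.
have -> : \sum_(Z <- wgrafts t X) GLmulL Z w =
    \sum_(Z <- wgrafts t X) \sum_(z <- grafts_on (nodes w) Z w) << z >>.
  by apply: eq_bigr => Z _; rewrite GLmulLE.
rewrite GLmulLE; exact: big_grafts_on_wgrafts.
Qed.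

HB.instance Definition _ :=
  GRing.isLinear.Build k {malg k[oforest]} {malg k[otree]} *:%R
    (@Bplus k) (linext_is_linear (fun X : oforest => << Node X >>)).

Lemma Bplus_wordU X : Bplus (wordU X) = << Node X >>.
Proof. by rewrite wordU.unlock; apply: linextU. Qed.

Lemma Bplus_sum (I : Type) (r : seq I) (P : pred I) (F : I -> {malg k[oforest]}) :
  Bplus (\sum_(i <- r | P i) F i) = \sum_(i <- r | P i) Bplus (F i).
Proof. exact: (linear_sum (@Bplus k)). Qed.

Lemma BplusD x y : Bplus (x + y) = Bplus x + Bplus y :> {malg k[otree]}.
Proof. exact: (linearD (@Bplus k)). Qed.

Lemma BplusB x y : Bplus (x - y) = Bplus x - Bplus y :> {malg k[otree]}.
Proof. exact: (linearB (@Bplus k)). Qed.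

Lemma lgraft_Node t Y :
  lgraft k t (Node Y) = << Node (t :: Y) >> + \sum_(Z <- wgrafts t Y) << Node Z >>.
Proof.
rewrite lgraftE big_map nodes_Node big_cons; congr (_ + _).
(* Away from the root only the list of children changes, and a function [F] of that list is general
   enough for induction. *)
suff H (F : seq otree -> {malg k[otree]}) :
    \sum_(s <- forest_nodes Y) F (children (graft_at t s (Node Y))) =
    \sum_(Z <- wgrafts t Y) F Z.
  rewrite -H !big_seq; apply: eq_bigr => s /forest_nodesP[f1 [u [f2 [r [-> -> _]]]]].
  by rewrite graft_at_cons.
elim: Y F => [|u Y IH] F; first by rewrite !big_nil.
rewrite big_wgrafts_cons -IH /= big_cat !big_map.
congr (_ + _).
  by apply: eq_bigr => s _; rewrite graft_at_cons /= eqxx.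
rewrite !big_seq; apply: eq_bigr => -[|i s].
  by rewrite (negbTE (nil_forest_nodes _)).
by move=> /forest_nodes_lt iY; rewrite !graft_at_cons /= gtn_eqF.
Qed.

(** Grafting at the root prepends [t] to the word and grafting elsewhere acts by the derivation;
    together they form the [circ]-product with [t]. *)
Lemma linext_lgraft_Bplus t x :
  linext (lgraft k t) (Bplus x) = Bplus (wordU [:: t] * x + graft_deriv t x).
Proof.
apply: (@eq_linear_words _ _ (linext (lgraft k t) \o @Bplus k)
  (@Bplus k \o (malg_mull (wordU [:: t]) \+ graft_deriv t))) => X.
change (linext (lgraft k t) (Bplus (wordU X)) =
        Bplus (wordU [:: t] * wordU X + graft_deriv t (wordU X))).
rewrite wordU_cat graft_derivU BplusD Bplus_sum !Bplus_wordU.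
transitivity (lgraft k t (Node X)); first exact: linextU.
by rewrite lgraft_Node; congr (_ + _); apply: eq_bigr => Z _;
   rewrite Bplus_wordU.
Qed.

(** [Bplus] intertwines the two products, as [GLmulL_cons] and [circL_cons] become the same
    recursion under [linext_lgraft_Bplus]. *)
Lemma GLmulL_Bplus X y : linext (GLmulL X) (Bplus y) = Bplus (circL X y).
Proof.
elim/word_strong_ind: X => [[|t X]] IH.
  rewrite circL_nil -[RHS]linext_id; apply: eq_linext => w; exact: GLmulL_nil.
rewrite circL_cons BplusB -linext_lgraft_Bplus Bplus_sum -IH //.
rewrite (eq_linext (GLmulL_cons t X)) linextDf linextNf linext_sumf.
apply: congr2; first by apply/esym; apply: linext_comp.
by congr (- _); apply: eq_big_wgrafts => Z sZ _; rewrite IH ?sZ.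
Qed.

End GrossmanLarson.

(** * From splittings of words to partitions of the index set *)

Lemma big_splits_subsets (T : finType) (V : zmodType)
    (F : seq T -> seq T -> V) (s : seq T) : uniq s ->
  \sum_(p <- splits s) F p.1 p.2 =
    \sum_(A : {set T} | A \subset [set x in s])
       F [seq x <- s | x \in A] [seq x <- s | x \notin A].
Proof.
elim: s F => [|x s IH] F.
  move=> _; rewrite big_seq1 (big_pred1 set0) // => A.
  have -> : [set x in [::]] = set0 :> {set T} by apply/setP => y; rewrite !inE.
  by rewrite subset0.
move=> /= /andP[xs us].
have sub_cons (A : {set T}) :
    (A \subset [set y in x :: s]) = (A :\ x \subset [set y in s]).
  apply/subsetP/subsetP => sub y.
    by rewrite !inE => /andP[/negbTE yx /sub]; rewrite !inE yx.
  have [->|yx yA] := eqVneq y x; first by rewrite !inE eqxx.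
  by have := sub y; rewrite !inE yx => /(_ yA) ->; rewrite orbT.
have xNs (A : {set T}) : A \subset [set y in s] -> x \notin A.
  by move=> /subsetP sub; apply: contra xs => /sub; rewrite inE.
rewrite big_splits_cons big_split /=.
rewrite (IH (fun a b => F (x :: a) b)) // (IH (fun a b => F a (x :: b))) //.
rewrite [RHS](bigID (fun A : {set T} => x \in A)) /=; congr (_ + _).
  rewrite [RHS](reindex_onto (fun A => x |: A) (fun A => A :\ x)) /=; last first.
    by move=> A /andP[_ xA]; rewrite setD1K.
  apply: eq_big => [A|A /xNs xA].
    rewrite sub_cons setU11 andbT; apply/idP/idP => [sA|/andP[sA /eqP <-//]].
    by rewrite setU1K ?sA ?eqxx // xNs.
  rewrite setU11 /=; congr (F (x :: _) _); apply: eq_in_filter => y ys;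
    by rewrite !inE; case: (eqVneq y x) => // yx; rewrite -yx ys in xs.
apply: eq_big => [A|A /xNs xA]; last by rewrite (negbTE xA).
rewrite sub_cons; apply/idP/andP => [sA|[sA xA]].
  by split; [apply: subset_trans sA; apply: subsetDl | apply: xNs].
by move: sA; rewrite (setDidPl _) // disjoint_sym disjoints1.
Qed.

Section Subforests.
Variables (m : nat) (t : m.-tuple otree).

Definition subword (I : {set 'I_m}) : seq otree := [seq tnth t i | i <- enum I].

Lemma subwordT : subword setT = t.
Proof. by rewrite /subword enum_setT -[RHS]map_tnth_enum enumT. Qed.

Lemma filter_enum (T : finType) (A I : {set T}) :
  [seq x <- enum I | x \in A] = enum (I :&: A).
Proof.
rewrite /enum_mem -filter_predI; apply: eq_filter => x /=.
by rewrite !inE andbC.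
Qed.

Lemma big_splits_subword (V : zmodType) (F : seq otree -> seq otree -> V) I :
  \sum_(p <- splits (subword I)) F p.1 p.2 =
    \sum_(A : {set 'I_m} | A \subset I) F (subword A) (subword (I :\: A)).
Proof.
rewrite splits_map big_map /=.
rewrite (big_splits_subsets (fun a b => F (map (tnth t) a) (map (tnth t) b)))
  ?enum_uniq //.
have -> : [set x in enum I] = I by apply/setP => x; rewrite inE mem_enum.
apply: eq_bigr => A AI; rewrite /subword filter_enum (setIidPr AI).
congr (F _ (map _ _)); rewrite setDE -filter_enum.
by apply: eq_filter => x; rewrite inE.
Qed.

End Subforests.

(** Ordered partitions of [I] into possibly empty blocks, in the recursive form that repeated
    splitting produces. *)
Fixpoint set_composition (T : finType) (I : {set T}) (s : seq {set T}) : bool :=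
  if s is A :: s' then (A \subset I) && set_composition (I :\: A) s' else I == set0.

(** Counting the blocks through each point expresses disjointness and covering at once, which eases
    the comparison with [GLpartition]. *)
Lemma set_compositionP (T : finType) (I : {set T}) s :
  reflect (forall x, count (fun A : {set T} => x \in A) s = (x \in I))
    (set_composition I s).
Proof.
elim: s I => [|A s IH] I /=.
  apply: (iffP eqP) => [-> x|H]; first by rewrite inE.
  by apply/setP => x; rewrite inE; have := H x; case: (x \in I).
apply: (iffP andP) => [[/subsetP AI /IH H] x|H].
  by rewrite H inE; case xA: (x \in A); rewrite ?(AI _ xA).
split; first by apply/subsetP => x xA; have := H x; rewrite xA; case: (x \in I).
apply/IH => x; have := H x; rewrite inE; case: (x \in A) => /=; last by rewrite add0n.
by rewrite add1n; case: (x \in I) => // -[].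
Qed.

Lemma GLpartitionP m q (B : q.+1.-tuple {set 'I_m}) :
  reflect ((forall x, count (fun A : {set 'I_m} => x \in A) B = 1%N) /\
           #|tnth B ord_max| = q) (GLpartition B).
Proof.
have cE x : count (fun A : {set 'I_m} => x \in A) B =
    (\sum_(i < q.+1) (x \in tnth B i))%N.
  by rewrite -sum1_count big_mkcond big_tuple; apply: eq_bigr => i _; case: (x \in _).
apply: (iffP and3P) => [[/forallP dis /eqP cov /eqP card]|[H /eqP card]].
  split=> // x; have /bigcupP[i _ xi] : x \in \bigcup_i tnth B i by rewrite cov inE.
  rewrite cE (bigD1 i) //= xi big1 // => j ji.
  have := forallP (dis j) i; rewrite ji /= => /pred0P/(_ x) /=; rewrite xi andbT.
  by move=> ->.
split=> //.
  apply/forallP => i; apply/forallP => j; apply/implyP => ij.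
  apply/pred0P => x /=; apply/negbTE/negP => /andP[xi xj].
  by have := H x; rewrite cE (bigD1 i) //= (bigD1 j) 1?eq_sym //= xi xj.
apply/eqP/setP => x; rewrite inE; apply/bigcupP.
have : has (fun A : {set 'I_m} => x \in A) B by rewrite has_count H.
by move=> /hasP[A /tnthP[i ->] xi]; exists i.
Qed.

Lemma GLpartition_rcons m q (B : q.-tuple {set 'I_m}) (J : {set 'I_m}) :
  GLpartition [tuple of rcons B J] = set_composition (~: J) B && (#|J| == q).
Proof.
have lastJ : tnth [tuple of rcons B J] ord_max = J.
  by rewrite (tnth_nth set0) /= nth_rcons size_tuple ltnn eqxx.
apply/GLpartitionP/andP => [[H]|[/set_compositionP H /eqP JQ]]; rewrite lastJ.
  move=> JQ; split; last exact/eqP.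
  apply/set_compositionP => x; have := H x; rewrite /= -cats1 count_cat /= addn0 inE.
  by case: (x \in J); rewrite ?addn1 ?addn0 //= => -[].
split=> // x; rewrite /= -cats1 count_cat /= addn0 H inE.
by case: (x \in J).
Qed.

Lemma big_tuple_cons (T : finType) (V : zmodType) q (P : pred (seq T))
    (F : seq T -> V) :
  \sum_(B : q.+1.-tuple T | P B) F B =
    \sum_(A : T) \sum_(B : q.-tuple T | P (A :: B)) F (A :: B).
Proof.
rewrite pair_big_dep /=.
rewrite (reindex (fun p : T * q.-tuple T => [tuple of p.1 :: p.2])) //=.
exists (fun B : q.+1.-tuple T => (thead B, [tuple of behead B])) => [[A B] _|B _] /=.
  by congr pair; apply: val_inj.
by rewrite [RHS]tuple_eta; apply: val_inj.
Qed.

Lemma big_tuple_rcons (T : finType) (V : zmodType) q (P : pred (q.+1.-tuple T))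
    (F : q.+1.-tuple T -> V) :
  \sum_(B | P B) F B =
    \sum_(A : T) \sum_(B : q.-tuple T | P [tuple of rcons B A])
       F [tuple of rcons B A].
Proof.
rewrite pair_big_dep /=.
rewrite (reindex (fun p : T * q.-tuple T => [tuple of rcons p.2 p.1])) //=.
exists (fun B : q.+1.-tuple T =>
    (tnth B ord_max, [tuple tnth B (widen_ord (leqnSn q) i) | i < q])).
  move=> [A B] _; congr pair.
    by rewrite (tnth_nth A) /= nth_rcons size_tuple ltnn eqxx.
  apply: eq_from_tnth => i; rewrite tnth_mktuple !(tnth_nth A) /=.
  by rewrite nth_rcons size_tuple ltn_ord.
move=> B _; apply: eq_from_tnth => i; rewrite (tnth_nth (tnth B ord_max)) /=.
rewrite nth_rcons size_map size_enum_ord.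
case: (ltngtP i q) => [iq|iq|iq].
- rewrite (nth_map (Ordinal iq)) ?size_enum_ord //; congr tnth; apply: val_inj.
  by rewrite /= nth_enum_ord.
- by have := leq_trans iq (ltn_ord i); rewrite ltnn.
- by congr tnth; apply: val_inj.
Qed.

(** * Expansion over partitions, the Grossman-Larson antipode and positivity *)

Section Formula.
Variable k : fieldType.
Local Notation wordU := (@wordU k).
Local Notation btri_word := (@btri_word k).
Local Notation circL := (@circL k).
Local Notation GLmulL := (@GLmulL k).

Section Expansion.
Variables (m : nat) (t : m.-tuple otree).
Local Notation subword := (subword t).

Lemma subforest_subword I : subforest t I = FMonom (subword I).
Proof. by []. Qed.

(** Iterates [btri_word_cat] down to single letters of [Y]; the successive splittings of [I] form
    the blocks. *)
Lemma btri_subword (Y : seq otree) I :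
  btri_word (subword I) Y =
    \sum_(B : (size Y).-tuple {set 'I_m} | set_composition I B)
       \prod_(p <- zip B Y) btri_word (subword p.1) [:: p.2].
Proof.
elim: Y I => [|y Y IH] I.
  rewrite btri_word_nilr; have -> : (subword I == [::]) = (I == set0).
    by rewrite -size_eq0 size_map -cardE cards_eq0.
  case I0: (I == set0); last first.
    by rewrite big_pred0 ?scale0r // => B; rewrite [B]tuple0 /= I0.
  rewrite scale1r (big_pred1 [tuple]) => [|B]; first by rewrite big_nil.
  by rewrite [B]tuple0 /= I0 eqxx.
rewrite (big_tuple_cons (size Y) (set_composition I)
  (fun B => \prod_(p <- zip B (y :: Y)) btri_word (subword p.1) [:: p.2])) /=.
rewrite -cat1s btri_word_cat.
rewrite (big_splits_subword t (fun a b => btri_word a [:: y] * btri_word b Y)).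
rewrite big_mkcond; apply: eq_bigr => A _.
case: (A \subset I) => /=; last by rewrite big_pred0.
rewrite IH mulr_sumr; apply: eq_bigr => B _.
by rewrite big_cons.
Qed.

Lemma splits_subsets (V : zmodType) (F : seq otree -> seq otree -> V) :
  \sum_(p <- splits (t : seq otree)) F p.1 p.2 =
    \sum_(I : {set 'I_m}) F (subword I) (subword (~: I)).
Proof.
rewrite -{1}(subwordT t) (big_splits_subword t F).
apply: eq_big => I; first by rewrite subsetT.
by rewrite setTD.
Qed.

End Expansion.

Section RhdAntipode.
Variable S : {linear {malg k[oforest]} -> {malg k[oforest]}}.
Hypothesis S_antipode : is_rhd_antipode S.

Lemma zip_mapr (T U W : Type) (f : U -> W) (r : seq T) (s : seq U) :
  zip r (map f s) = [seq (p.1, f p.2) | p <- zip r s].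
Proof. by elim: r s => [|x r IH] [|y s] //=; rewrite IH. Qed.

Lemma GLtermE m (t : m.-tuple otree) q (B : q.+1.-tuple {set 'I_m}) :
  GLterm S t B =
    Bplus (\prod_(p <- zip (take q B) (rev (subword t (tnth B ord_max))))
             btri_word (subword t p.1) [:: p.2]).
Proof.
rewrite /GLterm /subword -map_rev zip_mapr big_map; congr Bplus.
by apply: eq_bigr => p _; rewrite subforest_subword btri_tree.
Qed.

Lemma sum_GLterm m (t : m.-tuple otree) :
  \sum_(q < m.+1)
     \sum_(B : q.+1.-tuple {set 'I_m} | GLpartition B) GLterm S t B =
  Bplus (\sum_(p <- splits (t : seq otree)) btri_word p.1 (rev p.2)).
Proof.
rewrite (splits_subsets t (fun a b => btri_word a (rev b))) Bplus_sum.
(* The last block is the index set of the second part of a splitting, hence the passage to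
   complements; the sum is then grouped by the size of that block, at most [m], so [inord] is
   faithful. *)
rewrite [RHS](reindex_inj (@setC_inj _)) /=.
rewrite [RHS](partition_big (fun J : {set 'I_m} => inord #|J| : 'I_m.+1) xpredT) //=.
apply: eq_bigr => q _.
have qE (J : {set 'I_m}) : (inord #|J| == q) = (#|J| == q).
  rewrite -val_eqE /= inordK // ltnS -[X in (_ <= X)%N]card_ord.
  exact: max_card.
rewrite big_tuple_rcons [RHS]big_mkcond; apply: eq_bigr => J _.
rewrite qE; case: eqP => [JQ|JQ]; last first.
  by rewrite big_pred0 // => B; rewrite GLpartition_rcons (introF eqP JQ) andbF.
have sJ : size (rev (subword t J)) = q by rewrite size_rev size_map -cardE.
rewrite setCK btri_subword Bplus_sum sJ.
apply: eq_big => B; first by rewrite GLpartition_rcons JQ eqxx andbT.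
move=> _; rewrite GLtermE; congr (Bplus (\prod_(p <- zip _ (rev (subword t _))) _)).
  by rewrite /= -cats1 take_size_cat ?size_tuple.
by rewrite (tnth_nth set0) /= nth_rcons size_tuple ltnn eqxx.
Qed.

End RhdAntipode.

Section GLAntipode.
Variable S : {linear {malg k[otree]} -> {malg k[otree]}}.
Hypothesis S_antipode : is_GL_antipode S.

Lemma GLcoprodE X :
  GLcoprod (<< Node X >> : {malg k[otree]}) =
    \sum_(p <- splits X) << (Node p.1, Node p.2) >>.
Proof.
rewrite /GLcoprod linextU /GLcoprod_tree /=.
by rewrite -(splits_subsets (in_tuple X)
  (fun a b => << (Node a, Node b) >> : {malg k[(otree * otree)%type]})).
Qed.

Lemma GL_antipodeE X :
  \sum_(p <- splits X) linext (GLmulL p.1) (S << Node p.2 >>) =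
    (X == [::])%:R *: << one_node >>.
Proof.
have [_] := S_antipode << Node X >>.
have -> : GLcounit (<< Node X >> : {malg k[otree]}) = (X == [::])%:R.
  rewrite /GLcounit mcoeffU; congr (1 *+ nat_of_bool _).
  by apply/eqP/eqP => [[]|->].
rewrite /convolution GLcoprodE => <-; rewrite linear_sum; apply: eq_bigr => p _.
have -> : GLmulL p.1 = GLmul_tree k (Node p.1) by rewrite GLmulL.unlock.
apply: esym; apply: etrans (linextU _ _) _.
by rewrite /GLmul /bilinext; apply: linextU.
Qed.

(** Both sides are right convolution inverses for the Grossman-Larson product, the right one being
    the image of [circL_antipode_word] under [Bplus]; such inverses are unique. *)
Lemma GL_antipode_Node X : S << Node X >> = Bplus (antipode_word k X).
Proof.
move: X; apply: (splits_convolution_inj (op := fun X => linext (GLmulL X))) => [v|X].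
  by rewrite -[RHS]linext_id; apply: eq_linext => w; apply: GLmulL_nil.
rewrite GL_antipodeE; transitivity (Bplus ((X == [::])%:R *: 1 : {malg k[oforest]})).
  by rewrite -wordU_nil linearZ -Bplus_wordU.
rewrite -circL_antipode_word Bplus_sum; apply: eq_bigr => p _.
by rewrite GLmulL_Bplus.
Qed.

End GLAntipode.

Section Positivity.

(** A list of basis elements, with repetitions, certifies natural number coefficients without any
    order on [k], and is easily carried through sums and products. *)
Definition effective (K : choiceType) (x : {malg k[K]}) : Prop :=
  exists L : seq K, x = \sum_(a <- L) << a >>.

Lemma effectiveU (K : choiceType) (a : K) : effective << a >>.
Proof. by exists [:: a]; rewrite big_seq1. Qed.

Lemma effective_sum (K : choiceType) (I : eqType) (r : seq I) (F : I -> {malg k[K]}) :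
  (forall i, i \in r -> effective (F i)) -> effective (\sum_(i <- r) F i).
Proof.
elim: r => [|i r IH] H; first by exists [::]; rewrite !big_nil.
have [L eL] := H i (mem_head i r).
have [|M eM] := IH; first by move=> j jr; apply: H; rewrite inE jr orbT.
by exists (L ++ M); rewrite big_cons big_cat eL eM.
Qed.

Lemma effectiveM (K : monomType) (x y : {malg k[K]}) :
  effective x -> effective y -> effective (x * y).
Proof.
move=> [L ->] [M ->]; exists [seq mmul a b | a <- L, b <- M].
rewrite big_allpairs_dep mulr_suml; apply: eq_bigr => a _.
by rewrite mulr_sumr; apply: eq_bigr => b _; rewrite malgUM.
Qed.

Lemma effective_prod (I : Type) (r : seq I) (F : I -> {malg k[oforest]}) :
  (forall i, effective (F i)) -> effective (\prod_(i <- r) F i).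
Proof.
move=> H; elim/big_ind: _ => // [|x y]; last exact: effectiveM.
by rewrite -wordU_nil wordU.unlock; apply: effectiveU.
Qed.

(** The recursion [btri_word_cons] contains no signs. *)
Lemma effective_btri_word X Y : effective (btri_word X Y).
Proof.
elim/word_strong_ind: X Y => [[|t X]] IH Y.
  by rewrite btri_word_nill wordU.unlock; apply: effectiveU.
rewrite btri_word_cons.
have [L ->] : effective (\sum_(Z <- wgrafts t Y) btri_word X Z).
  by apply: effective_sum => Z _; apply: IH.
have [M ->] : effective (\sum_(Z <- wgrafts t X) btri_word Z Y).
  by apply: effective_sum => Z /size_wgrafts sZ; apply: IH; rewrite sZ.
by exists (L ++ M); rewrite big_cat.
Qed.

Lemma effective_Bplus x : effective x -> effective (Bplus x).
Proof.
move=> [L ->]; exists [seq Node a | a : oforest <- L].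
by rewrite big_map Bplus_sum; apply: eq_bigr => X _; apply: linextU.
Qed.

(** The coefficient of [s] is its multiplicity in the list; on the support it is nonzero in [k], so
    the multiplicity is positive. *)
Lemma effective_coefs (x : {malg k[otree]}) :
  effective x -> positive_integer_coefs x.
Proof.
move=> [L ->] s; rewrite -mcoeff_neq0.
have -> : (\sum_(a <- L) << a >> : {malg k[otree]})@_s = (count (pred1 s) L)%:R.
  rewrite (raddf_sum (mcoeff s)) -sum1_count natr_sum [RHS]big_mkcond.
  by apply: eq_bigr => a _; rewrite /= mcoeffU; case: eqP.
move=> nz; exists (count (pred1 s) L); split=> //.
by rewrite lt0n; apply: contraNneq nz => ->.
Qed.

End Positivity.
End Formula.

(* In [\sum_(q < m.+1)], q stands for |pi| - 1; since the last block is a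
   subset of [m] with q elements, q <= m is no restriction. *)
Theorem theorem4p6 (k : closedFieldType) (k_char0 : [pchar k] =i pred0)
  (S_GL : {linear {malg k[otree]} -> {malg k[otree]}})
  (S_GL_antipode : is_GL_antipode S_GL)
  (S_rhd : {linear {malg k[oforest]} -> {malg k[oforest]}})
  (S_rhd_antipode : is_rhd_antipode S_rhd)
  (m : nat) (t : m.-tuple otree) :
  S_GL (Bplus << FMonom t >>) =
    (-1) ^+ m *:
      \sum_(q < m.+1)
        \sum_(B : q.+1.-tuple {set 'I_m} | GLpartition B) GLterm S_rhd t B
  /\
  (forall (q : nat) (B : q.+1.-tuple {set 'I_m}),
     GLpartition B -> positive_integer_coefs (GLterm S_rhd t B)).
Proof.
split=> [|q B _].
  have -> : Bplus << FMonom t >> = << Node t >> :> {malg k[otree]}.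
    by rewrite -Bplus_wordU wordU.unlock.
  rewrite (GL_antipode_Node S_GL_antipode) (sum_GLterm S_rhd_antipode).
  by rewrite /antipode_word size_tuple; apply: linearZ_LR.
rewrite (GLtermE S_rhd_antipode); apply/effective_coefs/effective_Bplus.
by apply: effective_prod => p; apply: effective_btri_word.
Qed.
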